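(* Let $X$ be the solution on $I=[t_0,T]$ of the Stratonovich SDE $$\mathrm{d}X(t)=\sum_{m=0}^M\bigl(A_mX(t)+g_m(X(t))\bigr)\circ \mathrm{d}W_m(t),\qquad X(t_0)=X_0,$$ let $D\in\mathbb{R}^{d\times d}$ be symmetric, and put $\mathcal{I}(x)=x^\top D x$ for $x\in\mathbb{R}^d$. Assume: (i) $A_lA_k-A_kA_l=0$ for all $l,k=0,\dots,M$; (ii) each $A_m$, $m=0,\dots,M$, is skew-symmetric and commutes with $D$; (iii) $x^\top D g_m(x)=0$ for all $x\in\mathbb{R}^d$ and all $m=0,\dots,M$. Let $t_n\in I$ and let $V^n$ be the solution of the transformed system $$\mathrm{d}V^n(t)=\sum_{m=0}^M e^{-L^n(t)}g_m\bigl(e^{L^n(t)}V^n(t)\bigr)\circ \mathrm{d}W_m(t),\qquad t\in[t_n,T],$$ corresponding to $X$, i.e. $V^n(t)=e^{-L^n(t)}X(t)$, $V^n(t_n)=X(t_n)$. Then the transformed system preserves the same invariant as the original one: almost surely, for all $t\in[t_n,T]$, $$\mathcal{I}(V^n(t))=\mathcal{I}(X(t))=\mathcal{I}(X(t_0)).$$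
   Context: $W_0(t)=t$ and $W_1,\dots,W_M$ are independent one-dimensional Wiener processes; $\circ$ denotes Stratonovich integration. $A_0,\dots,A_M\in\mathbb{R}^{d\times d}$ are constant matrices, $g_m\in C^1(\mathbb{R}^d,\mathbb{R}^d)$, and the SDE for $X$ is assumed to have a unique solution on $I$ for every $X_0\in\mathbb{R}^d$. For $t\ge t_n$, $L^n(t)=\sum_{m=0}^MA_m\,(W_m(t)-W_m(t_n))$. *)

(* Defs.v *)
From HB Require Import structures.
From mathcomp Require Import all_boot all_order all_algebra.
From mathcomp Require Import all_classical all_reals all_analysis.

Set Implicit Arguments.
Unset Strict Implicit.
Unset Printing Implicit Defensive.

Import Order.TTheory GRing.Theory Num.Theory.
Import numFieldNormedType.Exports.

Local Open Scope classical_set_scope.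
Local Open Scope ring_scope.

Section linear_algebra.
Variables (R : realType) (d : nat).

Definition expmx (A : 'M[R]_d) : 'M[R]_d :=
  limn (series (fun k : nat => k`!%:R^-1 *: A ^+ k)).

Definition quad (D : 'M[R]_d) (x : 'cV[R]_d) : R := (x^T *m D *m x) ord0 ord0.

(* In finite dimension, continuity of x |-> 'd g x in operator norm is
   continuity of x |-> 'd g x v for every v. *)
Definition C1 (g : 'cV[R]_d -> 'cV[R]_d) :=
  (forall x, differentiable g x) /\
  (forall v, continuous (fun x => 'd g x v : 'cV[R]_d)).

End linear_algebra.

Section filtered_probability_space.
Context (dO : measure_display) (Omega : measurableType dO) (R : realType).
Variable P : probability Omega R.
Variables a b : R.

Definition filtration (F : R -> set (set Omega)) :=
  [/\ forall t, t \in `[a, b] -> sigma_algebra setT (F t),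
      forall t, t \in `[a, b] -> F t `<=` measurable &
      forall s t, s \in `[a, b] -> t \in `[a, b] -> s <= t -> F s `<=` F t].

Definition adapted (F : R -> set (set Omega)) (Y : R -> Omega -> R) :=
  forall t, t \in `[a, b] -> forall B, measurable B -> F t (Y t @^-1` B).

Definition sigma_generated (I : Type) (J : set I) (Y : I -> Omega -> R) :
    set (set Omega) :=
  <<s \bigcup_(i in J) preimage_set_system setT (Y i) measurable >>.

Definition independent (G H : set (set Omega)) :=
  forall A B, G A -> H B -> P (A `&` B) = (P A * P B)%E.

(* Only meant for classes containing setT, for which the product rule over the
   whole index type implies the product rule over every subfamily. *)
Definition mutually_independent (I : finType) (G : I -> set (set Omega)) :=
  forall E : I -> set Omega, (forall i, G i (E i)) ->
    P (\bigcap_i E i) = (\prod_(i : I) P (E i))%E.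

(* Wiener process on the time interval [a, b]. The value at time a is left
   free: the restriction to [a, b] of a Wiener process started at 0 at any
   earlier time is covered, as well as one started at 0 at time a.
   The second parameter of normal_prob is the standard deviation. *)
Definition wiener_process (B : R -> Omega -> R) :=
  [/\ forall t, t \in `[a, b] -> measurable_fun setT (B t),
      {ae P, forall w, {within `[a, b], continuous (fun t => B t w)}},
      forall s t, s \in `[a, b] -> t \in `[a, b] -> s < t ->
        forall V, measurable V ->
        P ((fun w => B t w - B s w) @^-1` V) =
        normal_prob 0 (Num.sqrt (t - s)) V &
      forall (n : nat) (s : nat -> R),
        (forall i, s i \in `[a, b]) -> (forall i, s i <= s i.+1) ->
        mutually_independent (fun i : 'I_n =>
          preimage_set_system setT (fun w => B (s i.+1) w - B (s i) w)
            measurable)].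

(* The last clause is joint in m: F s is independent of the increments after s
   of the whole vector (W m)_m. *)
Definition wiener_family (M : nat) (F : R -> set (set Omega))
    (W : 'I_M -> R -> Omega -> R) :=
  [/\ forall m, wiener_process (W m),
      mutually_independent (fun m => sigma_generated [set` `[a, b]] (W m)),
      forall m, adapted F (W m) &
      forall s, s \in `[a, b] ->
        independent (F s)
          (sigma_generated [set mt : 'I_M * R | mt.2 \in `[s, b]]
             (fun mt w => W mt.1 mt.2 w - W mt.1 s w))].

Definition cvg_in_probability (Z_ : nat -> Omega -> R) (Z : Omega -> R) :=
  forall e : R, 0 < e ->
    P [set w | e <= `|Z_ k w - Z w|] @[k --> \oo] --> 0%E.

End filtered_probability_space.

Section stratonovich.
Context (dO : measure_display) (Omega : measurableType dO) (R : realType).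
Variable P : probability Omega R.
Variable F : R -> set (set Omega).
Variables a b : R.

(* The points of the partition are those of a :: s, as in itv_partition. *)
Definition partition_sum (s : seq R) (h : R -> R -> R) : R :=
  \sum_(0 <= i < size s) h (nth a (a :: s) i) (nth a (a :: s) i.+1).

Definition mesh (s : seq R) : R :=
  \big[Num.max/0]_(0 <= i < size s)
    (nth a (a :: s) i.+1 - nth a (a :: s) i).

Definition limit_of_partition_sums (h : R -> R -> Omega -> R)
    (Z : R -> Omega -> R) :=
  forall t, t \in `[a, b] ->
  forall s_ : nat -> seq R, (forall k, itv_partition a t (s_ k)) ->
    mesh (s_ k) @[k --> \oo] --> 0 ->
    cvg_in_probability P
      (fun k w => partition_sum (s_ k) (fun u v => h u v w)) (Z t).

Definition continuous_process (V : topologicalType) (Y : R -> Omega -> V) :=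
  {ae P, forall w, {within `[a, b], continuous (fun t => Y t w)}}.

(* J(t) = \int_a^t Y dZ in the sense of Ito, for a continuous adapted integrand
   Y and a continuous semimartingale Z. When Z(t) = t this is the Riemann
   integral. *)
Definition ito_integral (Y Z J : R -> Omega -> R) :=
  [/\ adapted a b F J, continuous_process J &
      limit_of_partition_sums (fun u v w => Y u w * (Z v w - Z u w)) J].

(* Q = [Y, Z] for continuous Y and Z. As Y need not be a semimartingale (it is
   only a C^1 function of one in the applications), the finite variation of
   the paths of Q is part of the definition. *)
Definition covariation (Y Z Q : R -> Omega -> R) :=
  [/\ adapted a b F Q, continuous_process Q,
      {ae P, forall w, bounded_variation a b (fun t => Q t w)} &
      limit_of_partition_sums
        (fun u v w => (Y v w - Y u w) * (Z v w - Z u w)) Q].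

(* \int_a^t Y o dZ = \int_a^t Y dZ + 1/2 [Y, Z](t). *)
Definition stratonovich_integral (Y Z S : R -> Omega -> R) :=
  exists J Q : R -> Omega -> R,
    [/\ ito_integral Y Z J, covariation Y Z Q &
        {ae P, forall w, forall t, t \in `[a, b] ->
          S t w = J t w + 2^-1 * Q t w}].

(* X solves dX = \sum_m c_m o dZ_m on [a, b], X(a) = xi. The coefficients are
   given as processes, so that both coefficients of the form f (X t) and random
   time-dependent ones are covered. *)
Definition stratonovich_solution (n d : nat) (Z : 'I_n -> R -> Omega -> R)
    (c : 'I_n -> R -> Omega -> 'cV[R]_d) (xi : Omega -> 'cV[R]_d)
    (X : R -> Omega -> 'cV[R]_d) :=
  [/\ forall i, adapted a b F (fun t w => X t w i ord0),
      continuous_process X,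
      {ae P, forall w, X a w = xi w} &
      exists S : 'I_n -> R -> Omega -> 'cV[R]_d,
        (forall m i, stratonovich_integral (fun t w => c m t w i ord0) (Z m)
                       (fun t w => S m t w i ord0)) /\
        {ae P, forall w, forall t, t \in `[a, b] ->
          X t w = X a w + \sum_(m < n) S m t w}].

End stratonovich.

Section lawson.
Context (Omega : Type) (R : realType) (M d : nat).
Implicit Types (W : 'I_M -> R -> Omega -> R) (A : 'I_M.+1 -> 'M[R]_d).

(* W_0(t) = t; the Wiener process W_m, 1 <= m <= M, is W (m - 1). *)
Definition driver W (m : 'I_M.+1) (t : R) (w : Omega) : R :=
  if unlift ord0 m is Some k then W k t w else t.

Definition lawson_log W A (tn t : R) (w : Omega) : 'M[R]_d :=
  \sum_(m < M.+1) (driver W m t w - driver W m tn w) *: A m.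

Definition sde_coef A (g : 'I_M.+1 -> 'cV[R]_d -> 'cV[R]_d)
    (X : R -> Omega -> 'cV[R]_d) (m : 'I_M.+1) (t : R) (w : Omega) :=
  A m *m X t w + g m (X t w).

Definition transformed_coef W A (g : 'I_M.+1 -> 'cV[R]_d -> 'cV[R]_d) (tn : R)
    (V : R -> Omega -> 'cV[R]_d) (m : 'I_M.+1) (t : R) (w : Omega) :=
  expmx (- lawson_log W A tn t w) *m
    g m (expmx (lawson_log W A tn t w) *m V t w).

End lawson.

(* Main.v *)
(* By the product rule for symmetric (Stratonovich) sums,
   I(X_v) - I(X_u) = (y_u + y_v)^T (X_v - X_u) with y = D X, so that summing over
   a dyadic partition of [t0, t] writes I(X_t) - I(X_t0) with the increments of
   the integrals J = \int c dZ and of the covariations Q = [c, Z], where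
   c_m = A_m X + g_m(X) satisfies y^T c_m = 0 at every time.  As the partition is
   refined all the terms tend to 0 in probability:
   - the errors J_v - J_u - c_u (Z_v - Z_u) are compared with the Riemann sums over
     a finer dyadic partition, truncated at the modulus of continuity of c, to
     which the discrete Ito isometry applies;
   - X has tight quadratic sums, hence so does c, which is a C^1 function of X;
   - for this reason the increments of Q may be replaced by the products of the
     increments of c and Z, even against the weights y.
   The other equality is linear algebra: exp(-L) is orthogonal and commutes
   with D. *)
From HB Require Import structures.
Require Import Defs.
From mathcomp Require Import all_boot all_order all_algebra.
From mathcomp Require Import all_classical all_reals all_analysis.
From mathcomp Require Import measurable_realfun.
From mathcomp Require Import ring lra.
Set Implicit Arguments.
Unset Strict Implicit.
Unset Printing Implicit Defensive.

Import Order.TTheory GRing.Theory Num.Theory.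
Import numFieldNormedType.Exports.

Local Open Scope classical_set_scope.
Local Open Scope ring_scope.

(** * Outer probability *)

(** The hypotheses provide limits in probability only, at one time each and without a rate, whereas
    the number [2 ^ n] of error terms grows with [n]. Summing separate error bounds therefore leads
    nowhere. The way out is a pair of levels: [n] is fixed first, then [k] is taken so large that
    the [2 ^ n] limits along level [n + k] are all close at once, and what remains is estimated
    uniformly in [k]. That uniformity has two sources: a second moment bound for adapted sums, or
    tightness of the total masses of the terms. The processes come with continuous paths but without
    moments. Each path property (modulus, bound, variation) is therefore traded for a deterministic
    constant off an event of small probability, and an adapted cut-off, invisible on the good event,
    makes the second moments finite without stopping times. Time and the Wiener processes are
    treated alike through the single inequality [ito_driver], which asks for an upper bound with
    some constant instead of an exact isometry. *)

Section likely.
Context (dO : measure_display) (Omega : measurableType dO) (R : realType).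
Variable P : probability Omega R.
Implicit Types (Q : Omega -> Prop) (U V : nat -> Omega -> R).

(* [P] is additive on measurable sets only and [Q] need not be measurable. *)
Definition likely (eta : R) Q :=
  exists B, [/\ measurable B, (P B <= eta%:E)%E & forall w, ~ B w -> Q w].

Lemma likelyS eta eta' Q Q' : eta <= eta' -> (forall w, Q w -> Q' w) ->
  likely eta Q -> likely eta' Q'.
Proof.
move=> le_eta QQ' [B [mB PB BQ]]; exists B; split => // [|w /BQ/QQ'//].
by rewrite (le_trans PB)// lee_fin.
Qed.

Lemma likelyI eta eta' Q Q' : likely eta Q -> likely eta' Q' ->
  likely (eta + eta') (fun w => Q w /\ Q' w).
Proof.
move=> [B [mB PB BQ]] [B' [mB' PB' BQ']]; exists (B `|` B'); split.
- exact: measurableU.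
- rewrite EFinD (le_trans (measureU2 _ _ _))//.
  by rewrite leeD.
- by move=> w /not_orP[/BQ ? /BQ' ?].
Qed.

Lemma likely_ae eta Q : 0 <= eta -> {ae P, forall w, Q w} -> likely eta Q.
Proof.
move=> eta0 [N [mN PN NQ]]; exists N; split => //.
  by rewrite PN lee_fin.
by move=> w Nw; apply: contrapT => nQ; exact/Nw/NQ.
Qed.

Lemma likely_forall (I : finType) eta (Q : I -> Omega -> Prop) :
  (forall i, likely eta (Q i)) -> likely (eta *+ #|I|) (fun w => forall i, Q i w).
Proof.
move=> H.
have : forall s : seq I,
    likely (eta *+ size s) (fun w => forall i, i \in s -> Q i w).
  elim=> [|i s IH].
    by apply: likely_ae; [rewrite mulr0n | apply: aeW].
  rewrite mulrS; apply: (likelyS _ _ (likelyI (H i) IH)) => //=.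
  move=> w [Qi Qs] j; rewrite inE => /predU1P[->//|]; exact: Qs.
move=> /(_ (enum I)); rewrite -cardE; apply: likelyS => // w h i.
by apply: h; rewrite mem_enum.
Qed.

(** The intersection of exceptional sets of mass at most [1 / (n + 1)] is null. This is the way back
    from estimates in probability to almost sure statements. *)
Lemma ae_likely Q : (forall eta, 0 < eta -> likely eta Q) -> {ae P, forall w, Q w}.
Proof.
move=> H.
have /choice[B hB] : forall n : nat, exists B, [/\ measurable B,
    (P B <= (n.+1%:R^-1)%:E)%E & forall w, ~ B w -> Q w].
  by move=> n; apply: H; rewrite invr_gt0 ltr0n.
exists (\bigcap_n B n); split.
- by apply: bigcap_measurable => // n _; case: (hB n).
- apply/eqP; rewrite eq_le measure_ge0 andbT.
  apply/lee_addgt0Pr => e e0; rewrite add0e.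
  have [n _ /(_ _ (leqnn n)) ne] := near_infty_natSinv_lt (PosNum e0).
  have [mB PB _] := hB n.
  apply: le_trans (le_trans PB _); last by rewrite lee_fin ltW.
  apply: le_measure; rewrite ?inE//; last by move=> w; apply.
  by apply: bigcap_measurable => // k _; case: (hB k).
- by move=> w nQ n _; apply: contrapT => nB; apply: nQ; case: (hB n) => _ _; exact.
Qed.

(** [opP] and [OP] are the stochastic Landau symbols, read in outer probability: convergence to 0 in
    probability, and tightness of the tail of the sequence. *)
Definition opP U := forall e eta, 0 < e -> 0 < eta ->
  \forall k \near \oo, likely eta (fun w => `|U k w| <= e).

Definition OP U := forall eta, 0 < eta -> exists2 K, 0 < K &
  \forall k \near \oo, likely eta (fun w => `|U k w| <= K).

Lemma opP_le U V :
  (forall eta, 0 < eta -> \forall k \near \oo, likely eta (fun w => `|U k w| <= `|V k w|)) ->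
  opP V -> opP U.
Proof.
move=> UV oV e eta e0 eta0.
have eta2 : 0 < eta / 2 by rewrite divr_gt0.
near=> k; have -> : eta = eta / 2 + eta / 2 by rewrite -splitr.
have h1 : likely (eta / 2) (fun w => `|U k w| <= `|V k w|) by near: k; exact: UV.
have h2 : likely (eta / 2) (fun w => `|V k w| <= e) by near: k; exact: oV.
apply: (likelyS (lexx _) _ (likelyI h1 h2)) => w [uv ve]; exact: le_trans ve.
Unshelve. all: end_near. Qed.

Lemma OP_le U V :
  (forall eta, 0 < eta -> \forall k \near \oo, likely eta (fun w => `|U k w| <= `|V k w|)) ->
  OP V -> OP U.
Proof.
move=> UV oV eta eta0.
have eta2 : 0 < eta / 2 by rewrite divr_gt0.
have [K K0 hK] := oV _ eta2; exists K => //.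
near=> k; have -> : eta = eta / 2 + eta / 2 by rewrite -splitr.
have h1 : likely (eta / 2) (fun w => `|U k w| <= `|V k w|) by near: k; exact: UV.
have h2 : likely (eta / 2) (fun w => `|V k w| <= K) by near: k.
apply: (likelyS (lexx _) _ (likelyI h1 h2)) => w [uv ve]; exact: le_trans ve.
Unshelve. all: end_near. Qed.

Lemma ae_near_likely (Q : nat -> Omega -> Prop) :
  {ae P, forall w, forall k, Q k w} ->
  forall eta : R, 0 < eta -> \forall k \near \oo, likely eta (Q k).
Proof.
move=> H eta eta0; near=> k; apply: likely_ae; first exact: ltW.
by apply: filterS H => w; exact.
Unshelve. all: end_near. Qed.

Lemma opP0 : opP (fun _ _ => 0).
Proof.
move=> e eta e0 eta0; apply: ae_near_likely => //; apply: aeW => w k /=.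
by rewrite normr0 ltW.
Qed.

Lemma opPD U V : opP U -> opP V -> opP (fun k w => U k w + V k w).
Proof.
move=> oU oV e eta e0 eta0.
have e2 : 0 < e / 2 by rewrite divr_gt0.
have eta2 : 0 < eta / 2 by rewrite divr_gt0.
near=> k; have -> : eta = eta / 2 + eta / 2 by rewrite -splitr.
have h1 : likely (eta / 2) (fun w => `|U k w| <= e / 2) by near: k; exact: oU.
have h2 : likely (eta / 2) (fun w => `|V k w| <= e / 2) by near: k; exact: oV.
apply: (likelyS (lexx _) _ (likelyI h1 h2)) => w [u v].
by rewrite (splitr e) (le_trans (ler_normD _ _))// lerD.
Unshelve. all: end_near. Qed.

Lemma OPD U V : OP U -> OP V -> OP (fun k w => U k w + V k w).
Proof.
move=> oU oV eta eta0.
have eta2 : 0 < eta / 2 by rewrite divr_gt0.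
have [K K0 hK] := oU _ eta2; have [K' K'0 hK'] := oV _ eta2.
exists (K + K'); first exact: addr_gt0.
near=> k; have -> : eta = eta / 2 + eta / 2 by rewrite -splitr.
have h1 : likely (eta / 2) (fun w => `|U k w| <= K) by near: k.
have h2 : likely (eta / 2) (fun w => `|V k w| <= K') by near: k.
apply: (likelyS (lexx _) _ (likelyI h1 h2)) => w [u v].
by rewrite (le_trans (ler_normD _ _))// lerD.
Unshelve. all: end_near. Qed.

Lemma OP_cst (c : R) : OP (fun _ _ => c).
Proof.
move=> eta eta0; exists (`|c| + 1); first by rewrite ltr_wpDl.
by apply: ae_near_likely => //; apply: aeW => w k /=; rewrite lerDl.
Qed.

Lemma OP_opP U : opP U -> OP U.
Proof. by move=> oU eta eta0; exists 1 => //; exact: oU. Qed.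

Lemma opPM U V : OP U -> opP V -> opP (fun k w => U k w * V k w).
Proof.
move=> oU oV e eta e0 eta0.
have eta2 : 0 < eta / 2 by rewrite divr_gt0.
have [K K0 hK] := oU _ eta2.
have eK : 0 < e / K by rewrite divr_gt0.
near=> k; have -> : eta = eta / 2 + eta / 2 by rewrite -splitr.
have h1 : likely (eta / 2) (fun w => `|U k w| <= K) by near: k.
have h2 : likely (eta / 2) (fun w => `|V k w| <= e / K) by near: k; exact: oV.
apply: (likelyS (lexx _) _ (likelyI h1 h2)) => w [u v].
rewrite normrM (le_trans (ler_pM _ _ u v))//.
by rewrite mulrC divfK// gt_eqF.
Unshelve. all: end_near. Qed.

Lemma OPM U V : OP U -> OP V -> OP (fun k w => U k w * V k w).
Proof.
move=> oU oV eta eta0.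
have eta2 : 0 < eta / 2 by rewrite divr_gt0.
have [K K0 hK] := oU _ eta2; have [K' K'0 hK'] := oV _ eta2.
exists (K * K'); first exact: mulr_gt0.
near=> k; have -> : eta = eta / 2 + eta / 2 by rewrite -splitr.
have h1 : likely (eta / 2) (fun w => `|U k w| <= K) by near: k.
have h2 : likely (eta / 2) (fun w => `|V k w| <= K') by near: k.
apply: (likelyS (lexx _) _ (likelyI h1 h2)) => w [u v].
by rewrite normrM ler_pM.
Unshelve. all: end_near. Qed.

Lemma opPZ c U : opP U -> opP (fun k w => c * U k w).
Proof. exact/opPM/OP_cst. Qed.

Lemma opP_sum (I : finType) (U : I -> nat -> Omega -> R) :
  (forall i, opP (U i)) -> opP (fun k w => \sum_i U i k w).
Proof.
move=> oU; rewrite /index_enum; elim: (Finite.enum _) => [|i s IH].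
  apply: opP_le opP0 => eta eta0; apply: ae_near_likely => //.
  by apply: aeW => w k /=; rewrite big_nil.
apply: opP_le (opPD (oU i) IH) => eta eta0; apply: ae_near_likely => //.
by apply: aeW => w k /=; rewrite big_cons.
Qed.

Lemma opP_sqr U : opP (fun k w => U k w ^+ 2) -> opP U.
Proof.
move=> oU e eta e0 eta0.
have e2 : 0 < e ^+ 2 by rewrite exprn_gt0.
apply: filterS (oU _ _ e2 eta0) => k; apply: likelyS => // w.
rewrite normrX ler_pXn2r// nnegrE//; exact: ltW.
Qed.

(** Continuity of [P] from above. It replaces a constant that depends on the path by a deterministic
    one, off a small event; the need for measurable nested sets dictates the form of [B] in each
    application. *)
Lemma likely_nonincreasing (B : nat -> set Omega) :
  (forall n, measurable (B n)) -> (forall n, B n.+1 `<=` B n) ->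
  {ae P, forall w, exists n, ~ B n w} ->
  forall eta, 0 < eta -> exists n, likely eta (fun w => ~ B n w).
Proof.
move=> mB dB [N [mN PN0 NB]] eta eta0.
have : P (B n) @[n --> \oo] --> P (\bigcap_n B n).
  apply: nonincreasing_cvg_mu => //.
  - by rewrite (le_lt_trans (probability_le1 _ _))// ltry.
  - exact: bigcap_measurable.
  - by apply/nonincreasing_seqP => n; exact/subsetPset/dB.
have -> : P (\bigcap_n B n) = 0%E.
  apply/eqP; rewrite eq_le measure_ge0 andbT -PN0.
  apply: le_measure; rewrite ?inE//; first exact: bigcap_measurable.
  by move=> w Bw; apply: NB => -[n]; apply; exact: Bw.
move=> /fine_cvgP[_ /cvgrPdist_lt /(_ _ eta0)] [n _ /(_ _ (leqnn n))] /=.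
rewrite add0r normrN ger0_norm ?fine_ge0// => h; exists n, (B n); split => //.
  by rewrite -[P _]fineK ?fin_num_measure// lee_fin ltW.
Qed.

End likely.

(** * Continuous processes *)

Lemma measurable_set_ltr d (T : measurableType d) (R : realType) (f g : T -> R) :
  measurable_fun setT f -> measurable_fun setT g ->
  measurable [set x | f x < g x].
Proof.
move=> mf mg; have := measurable_fun_ltr mf mg.
by move=> /(_ measurableT [set true] I); rewrite setTI.
Qed.

Lemma measurable_set_ler d (T : measurableType d) (R : realType) (f g : T -> R) :
  measurable_fun setT f -> measurable_fun setT g ->
  measurable [set x | f x <= g x].
Proof.
move=> mf mg; have := measurable_fun_ler mf mg.
by move=> /(_ measurableT [set true] I); rewrite setTI.
Qed.

Section path_regularity.
Context (R : realType).
Implicit Types (a b x e : R) (f : R -> R).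

Lemma within_itv_continuousE a b f x e : {within `[a, b], continuous f} ->
  x \in `[a, b] -> 0 < e -> exists2 r, 0 < r &
    forall y, y \in `[a, b] -> `|x - y| < r -> `|f x - f y| < e.
Proof.
move=> /subspace_continuousP fc xab e0.
have /cvgrPdist_lt/(_ _ e0) := fc x xab.
rewrite near_withinE => -[r /= r0 H]; exists r => // y yab xy.
by apply: H.
Qed.

(** Heine's theorem from the covering form of compactness: the radius is the parameter that tends to
    0 from the right, and half of a radius valid at [x] serves all points near [x]. *)
Lemma within_itv_unif_continuous a b f e : {within `[a, b], continuous f} ->
  0 < e -> exists2 r, 0 < r & forall x y, x \in `[a, b] -> y \in `[a, b] ->
    `|x - y| < r -> `|f x - f y| < e.
Proof.
move=> fc e0; have e2 : 0 < e / 2 by rewrite divr_gt0.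
pose Q (r x : R) := forall y, x \in `[a, b] -> y \in `[a, b] ->
  `|x - y| < r -> `|f x - f y| < e.
have /compact_near_coveringP cov : compact `[a, b]%classic.
  exact: segment_compact.
have H x : `[a, b]%classic x -> \forall x' \near x & i \near (0 : R)^'+, Q i x'.
  move=> xab; have [r r0 hr] := within_itv_continuousE fc xab e2.
  have r2 : 0 < r / 2 by rewrite divr_gt0.
  exists ([set x' | `|x - x'| < r / 2], [set i | i < r / 2]) => /=.
    split; first by exists (r / 2).
    exists (r / 2) => //= z; rewrite /= sub0r normrN => zr z0.
    by rewrite gtr0_norm in zr.
  move=> [u i]/= [xu ir] y uab yab uy.
  have h1 : `|f x - f u| < e / 2 by apply: hr => //; lra.
  have h2 : `|f x - f y| < e / 2.
    apply: hr => //; have -> : x - y = (x - u) + (u - y) by ring.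
    by rewrite (le_lt_trans (ler_normD _ _))//; lra.
  have -> : f u - f y = (f x - f y) - (f x - f u) by ring.
  by rewrite (le_lt_trans (ler_normB _ _))//; lra.
have [r /= r0 Hr] := cov _ (0 : R)^'+ Q _ H.
have r2 : 0 < r / 2 by rewrite divr_gt0.
exists (r / 2) => // x y xab yab xy; apply: (Hr (r / 2)) => //=.
by rewrite sub0r normrN gtr0_norm// ltr_pdivrMr// ltr_pMr// ltr1n.
Qed.

Lemma within_itv_bounded a b f : {within `[a, b], continuous f} ->
  exists K, forall x, x \in `[a, b] -> `|f x| <= K.
Proof.
move=> fc; have : compact (f @` `[a, b]%classic).
  by apply: continuous_compact => //; exact: segment_compact.
move=> /compact_bounded[K [_ HK]]; exists (K + 1) => x xab.
by apply: (HK (K + 1)); [rewrite ltrDl | exists x].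
Qed.

End path_regularity.

Section processes.
Context (dO : measure_display) (Omega : measurableType dO) (R : realType).
Variable P : probability Omega R.
Variables (a b : R) (ab : a <= b).
Implicit Types (Y Z : R -> Omega -> R).

Definition measurable_process Y :=
  forall u, u \in `[a, b] -> measurable_fun setT (Y u).

(* Clipping the rationals to [a, b] gives a countable dense subset. *)
Definition clip_rat (q : rat) : R := Num.max a (Num.min b (ratr q)).
Local Notation clip := clip_rat.

Lemma clip_in q : clip q \in `[a, b].
Proof. by rewrite /clip_rat in_itv/= le_max lexx ge_max ab ge_min lexx. Qed.

Lemma clip_dense (x r : R) : x \in `[a, b] -> 0 < r -> exists q, `|x - clip q| < r.
Proof.
rewrite in_itv/= => /andP[ax xb] r0.
have xr : x - r < x + r by lra.
have [q] := rat_in_itvoo xr.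
rewrite in_itv/= => /andP[q1 q2]; exists q; rewrite /clip_rat ltr_norml.
rewrite /Num.max /Num.min; 
by case: (ltP b (ratr q)) => h2; case: (ltP a _) => h1; apply/andP; split; lra.
Qed.

(** Bad pairs of times are uncountably many. Restricting them to clipped rationals keeps the bad
    sets measurable, and path continuity then extends the bound to all pairs. *)
Lemma continuous_process_modulus Y : measurable_process Y ->
  continuous_process P a b Y -> forall e eta : R, 0 < e -> 0 < eta ->
  exists2 del, 0 < del & likely P eta (fun w => forall u v, u \in `[a, b] ->
    v \in `[a, b] -> `|u - v| <= del -> `|Y u w - Y v w| <= e).
Proof.
move=> mY cY e eta e0 eta0.
(* The radius is [2 / n.+1%:R] although [del] will be [n.+1%:R^-1]: the margin absorbs the
   displacement of [u] and [v] to clipped rationals, each by less than half of [n.+1%:R^-1]. *)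
pose bad (n : nat) (q : rat * rat) : set Omega :=
  if `|clip q.1 - clip q.2| < 2 / n.+1%:R then
    [set w | e < `|Y (clip q.1) w - Y (clip q.2) w|] else set0.
pose B n := \bigcup_q bad n q.
have mB n : measurable (B n).
  apply: countable_bigcupT_measurable; first exact: countableP.
  move=> q; rewrite /bad; case: ifP => // _.
  apply: measurable_set_ltr => //.
  by apply: measurableT_comp => //; apply: measurable_funB; apply: mY; exact: clip_in.
have dB n : B n.+1 `<=` B n.
  move=> w [q _]; rewrite /bad; case: ifPn => // h Yw; exists q => //.
  rewrite /bad ifT// (lt_le_trans h)// ler_pM2l//.
  by rewrite lef_pV2 ?posrE// ler_nat.
have aeB : {ae P, forall w, exists n, ~ B n w}.
  apply: filterS cY => w cw.
  have [r r0 hr] := within_itv_unif_continuous cw e0.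
  have r2 : 0 < r / 2 by rewrite divr_gt0.
  have [n _ /(_ _ (leqnn n)) ne] := near_infty_natSinv_lt (PosNum r2).
  exists n => -[q _]; rewrite /bad; case: ifPn => // h.
  rewrite /= ltNge (ltW (hr _ _ (clip_in _) (clip_in _) _))// (lt_trans h)//.
  by move: ne => /=; move: (n.+1%:R^-1) => c; lra.
have [n] := likely_nonincreasing mB dB aeB eta0.
have cY0 : likely P 0 (fun w => {within `[a, b], continuous (fun t => Y t w)}).
  exact: likely_ae cY.
move=> /likelyI/(_ cY0); rewrite addr0 => H.
exists (n.+1%:R^-1); first by rewrite invr_gt0 ltr0n.
apply: likelyS H => // w [nB cw] u v uab vab uv.
rewrite leNgt; apply/negP => euv.
(* Half of the excess over [e]: changing each of the two values by less than [g] leaves a difference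
   above [e] at the rationals. *)
pose g := (`|Y u w - Y v w| - e) / 2.
have g0 : 0 < g by rewrite divr_gt0// subr_gt0.
have [r1 r10 h1] := within_itv_continuousE cw uab g0.
have [r2 r20 h2] := within_itv_continuousE cw vab g0.
have n0 : 0 < (n.+1%:R^-1 : R) / 2 by rewrite divr_gt0// invr_gt0 ltr0n.
have m1 : 0 < Num.min r1 (n.+1%:R^-1 / 2) by rewrite lt_min r10 n0.
have [q1] := clip_dense uab m1.
rewrite lt_min => /andP[q11 q12].
have m2 : 0 < Num.min r2 (n.+1%:R^-1 / 2) by rewrite lt_min r20 n0.
have [q2] := clip_dense vab m2.
rewrite lt_min => /andP[q21 q22].
apply: nB; exists (q1, q2) => //; rewrite /bad/= ifT; last first.
  have -> : clip q1 - clip q2 = (u - v) - (u - clip q1) + (v - clip q2) by ring.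
  rewrite (le_lt_trans (ler_normD _ _))//.
  have := ler_normB (u - v) (u - clip q1); move: uv q12 q22; move: (n.+1%:R^-1) => c.
  lra.
have {}h1 := h1 _ (clip_in q1) q11; have {}h2 := h2 _ (clip_in q2) q21.
have : `|Y u w - Y v w| <= `|Y (clip q1) w - Y (clip q2) w| +
    (`|Y u w - Y (clip q1) w| + `|Y v w - Y (clip q2) w|).
  have -> : Y u w - Y v w = (Y (clip q1) w - Y (clip q2) w) +
    ((Y u w - Y (clip q1) w) - (Y v w - Y (clip q2) w)) by ring.
  by rewrite (le_trans (ler_normD _ _))// lerD2l ler_normB.
by move: h1 h2; rewrite /g /=; lra.
Qed.

Lemma continuous_process_bounded Y : measurable_process Y ->
  continuous_process P a b Y -> forall eta : R, 0 < eta -> exists2 K, 0 < K &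
  likely P eta (fun w => forall u, u \in `[a, b] -> `|Y u w| <= K).
Proof.
move=> mY cY eta eta0.
pose B (n : nat) := \bigcup_q [set w | n%:R < `|Y (clip q) w|].
have mB n : measurable (B n).
  apply: bigcupT_measurable_rat => q.
  apply: measurable_set_ltr => //.
  by apply: measurableT_comp => //; apply: mY; exact: clip_in.
have dB n : B n.+1 `<=` B n.
  by move=> w [q _ /= h]; exists q => //=; rewrite (lt_trans _ h)// ltr_nat.
have aeB : {ae P, forall w, exists n, ~ B n w}.
  apply: filterS cY => w cw.
  have [K hK] := within_itv_bounded cw.
  exists (Num.truncn K).+1 => -[q _] /=.
  by rewrite ltNge (le_trans (hK _ (clip_in q)))// ltW// truncnS_gt.
have [n] := likely_nonincreasing mB dB aeB eta0.
have cY0 : likely P 0 (fun w => {within `[a, b], continuous (fun t => Y t w)}).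
  exact: likely_ae cY.
move=> /likelyI/(_ cY0); rewrite addr0 => H.
(* The additional 1 pays for the passage from clipped rationals, where the bound is [n], to
   arbitrary times. *)
exists (n%:R + 1); first by rewrite ltr_wpDl.
apply: likelyS H => // w [nB cw] u uab.
have [r r0 hr] := within_itv_continuousE cw uab ltr01.
have [q /(hr _ (clip_in _))] := clip_dense uab r0.
have : `|Y (clip q) w| <= n%:R.
  by rewrite leNgt; apply/negP => h; apply: nB; exists q.
move=> h1 h2; rewrite -(subrK (Y (clip q) w) (Y u w)).
rewrite (le_trans (ler_normD _ _))//.
by rewrite addrC lerD// ltW.
Qed.

End processes.

(** * Dyadic partitions *)

Section dyadic.
Context (R : realType).
Variables (a t : R).
Hypothesis at_ : a < t.

Definition dyad (n j : nat) : R := a + (t - a) * j%:R / 2 ^+ n.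

(** Index 0 is left out because [itv_partition] and [partition_sum] put [a] in front of the list.
    With [i] points this partitions the interval from [a] to [dyad n i] only. *)
Definition dyad_seq (n i : nat) : seq R := [seq dyad n j | j <- iota 1 i].

Lemma dyad0 n : dyad n 0 = a.
Proof. by rewrite /dyad mulr0 mul0r addr0. Qed.

Lemma dyad_last n : dyad n (2 ^ n) = t.
Proof. by rewrite /dyad natrX mulfK ?expf_neq0//; ring. Qed.

Lemma dyad_step n j : dyad n j.+1 - dyad n j = (t - a) / 2 ^+ n.
Proof. by rewrite /dyad -natr1; ring. Qed.

Lemma dyad_step_gt0 n : 0 < (t - a) / 2 ^+ n.
Proof. by rewrite divr_gt0 ?subr_gt0 ?exprn_gt0. Qed.

Lemma dyadB n i j : dyad n j - dyad n i = (j%:R - i%:R) * ((t - a) / 2 ^+ n).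
Proof. by rewrite /dyad; ring. Qed.

Lemma dyad_lt n i j : (i < j)%N -> dyad n i < dyad n j.
Proof.
by move=> ij; rewrite -subr_gt0 dyadB mulr_gt0 ?dyad_step_gt0// subr_gt0 ltr_nat.
Qed.

Lemma dyad_le n i j : (i <= j)%N -> dyad n i <= dyad n j.
Proof. by rewrite leq_eqVlt => /predU1P[->//|/dyad_lt/ltW]; exact. Qed.

Lemma dyad_in n j : (j <= 2 ^ n)%N -> dyad n j \in `[a, t].
Proof. move=> jn; rewrite in_itv/=; apply/andP; split.
  by rewrite -[leLHS](dyad0 n) dyad_le.
by rewrite -[leRHS](dyad_last n) dyad_le. Qed.

Lemma dyad_refine n k j : dyad (n + k) (j * 2 ^ k) = dyad n j.
Proof.
rewrite /dyad natrM natrX exprD invfM; congr (_ + _).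
have : (2 : R) ^+ k != 0 by rewrite expf_neq0.
have : (2 : R) ^+ n != 0 by rewrite expf_neq0.
by move=> *; field; apply/andP.
Qed.

Lemma sum_refine n k (f : nat -> R) :
  \sum_(0 <= j < 2 ^ (n + k)) f j =
  \sum_(0 <= i < 2 ^ n) \sum_(i * 2 ^ k <= j < i.+1 * 2 ^ k) f j.
Proof. by rewrite expnD big_nat_mul. Qed.

Lemma nth_dyad_seq n i j : (j <= i)%N -> nth a (a :: dyad_seq n i) j = dyad n j.
Proof.
case: j => [|j] ji; first by rewrite /= dyad0.
by rewrite /= (nth_map 0%N) ?size_iota// nth_iota// add1n.
Qed.

Lemma dyad_seq_partition n i : itv_partition a (dyad n i) (dyad_seq n i).
Proof.
split.
  apply/(pathP a) => j; rewrite size_map size_iota => ji.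
  have := nth_dyad_seq n ji; rewrite /= => ->.
  by rewrite nth_dyad_seq ?dyad_lt// ltnW.
by rewrite (last_nth a) size_map size_iota nth_dyad_seq.
Qed.

Lemma partition_sum_dyad n i (h : R -> R -> R) :
  partition_sum a (dyad_seq n i) h =
  \sum_(0 <= j < i) h (dyad n j) (dyad n j.+1).
Proof.
rewrite /partition_sum size_map size_iota; apply: eq_big_nat => j /andP[_ ji].
by rewrite !nth_dyad_seq// ltnW.
Qed.

Lemma mesh_dyad_le n i : 0 <= mesh a (dyad_seq n i) <= (t - a) / 2 ^+ n.
Proof.
rewrite /mesh size_map size_iota; apply/andP; split.
  by rewrite big_mkord; exact: bigmax_ge_id.
rewrite big_mkord; apply/bigmax_leP; split; first exact/ltW/dyad_step_gt0.
by move=> j _; rewrite !nth_dyad_seq ?dyad_step// ltnW.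
Qed.

Lemma cvg_dyad_step n : (t - a) / 2 ^+ (n + k) @[k --> \oo] --> 0.
Proof.
have -> : (fun k => (t - a) / 2 ^+ (n + k)) = geometric ((t - a) / 2 ^+ n) 2^-1.
  apply/funext => k; rewrite /geometric/= exprD invfM mulrA.
  by rewrite exprVn.
by apply: cvg_geometric; rewrite ger0_norm// invf_lt1// ltr1n.
Qed.

Lemma near_dyad_step (e : R) : 0 < e -> \forall n \near \oo, (t - a) / 2 ^+ n <= e.
Proof.
move=> e0; have /cvgrPdist_le/(_ _ e0) := cvg_dyad_step 0.
apply: filterS => n; rewrite add0n sub0r normrN ger0_norm//.
exact/ltW/dyad_step_gt0.
Qed.

Lemma mesh_dyad_cvg n i : mesh a (dyad_seq (n + k) (i * 2 ^ k)) @[k --> \oo] --> 0.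
Proof.
apply: (squeeze_cvgr _ (cvg_cst 0) (cvg_dyad_step n)).
by near=> k; exact: mesh_dyad_le.
Unshelve. all: end_near. Qed.

Lemma variation_dyad n (f : R -> R) : variation a t f (dyad_seq n (2 ^ n)) =
  \sum_(0 <= j < 2 ^ n) `|f (dyad n j.+1) - f (dyad n j)|.
Proof.
rewrite /variation size_map size_iota; apply: eq_big_nat => j /andP[_ ji].
have nthE k : (k <= 2 ^ n)%N ->
    nth t (a :: dyad_seq n (2 ^ n)) k = dyad n k.
  move=> kn; rewrite -(nth_dyad_seq n kn); apply: set_nth_default.
  by rewrite /= size_map size_iota ltnS.
by rewrite /comp !nthE// ltnW.
Qed.

End dyadic.

Section dyadic_processes.
Context (dO : measure_display) (Omega : measurableType dO) (R : realType).
Variable P : probability Omega R.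
Variables (a b t : R) (at_ : a < t) (tb : t <= b).
Implicit Types (Y Z : R -> Omega -> R).
Local Notation tau := (dyad a t).

Lemma dyad_in_ab n j : (j <= 2 ^ n)%N -> tau n j \in `[a, b].
Proof.
move=> /(dyad_in at_); rewrite !in_itv/= => /andP[-> h].
exact: le_trans tb.
Qed.

Lemma measurable_sum_nat m n (f : nat -> Omega -> R) :
  (forall j, (m <= j < n)%N -> measurable_fun setT (f j)) ->
  measurable_fun setT (fun w => \sum_(m <= j < n) f j w).
Proof.
move=> mf; have -> : (fun w => \sum_(m <= j < n) f j w) =
    (fun w => \sum_(j <- index_iota m n)
      (if (m <= j < n)%N then f j w else 0)).
  by apply/funext => w; apply: eq_big_nat => j jmn; rewrite jmn.
by apply: measurable_sum => j; case jmn: (m <= j < n)%N => //; exact: mf.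
Qed.

(** Point [i] of level [n] is point [i * 2 ^ k] of level [n + k], so the finer levels partition the
    interval from [a] to [tau n i] with mesh tending to 0. Measurability makes the deviation event
    itself an admissible exceptional set. *)
Lemma limit_dyadic (h : R -> R -> Omega -> R) Z :
  limit_of_partition_sums P a b h Z ->
  (forall u v, u \in `[a, b] -> v \in `[a, b] -> measurable_fun setT (h u v)) ->
  measurable_process a b Z -> forall n i, (i <= 2 ^ n)%N ->
  opP P (fun k w => \sum_(0 <= j < i * 2 ^ k)
    h (tau (n + k) j) (tau (n + k) j.+1) w - Z (tau n i) w).
Proof.
move=> hZ mh mZ n i ni e eta e0 eta0.
have tni := dyad_in_ab ni.
have part k : itv_partition a (tau n i) (dyad_seq a t (n + k) (i * 2 ^ k)).
  by rewrite -(dyad_refine a t n k); exact: dyad_seq_partition.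
have := hZ _ tni _ part (mesh_dyad_cvg at_ n i) e e0.
move=> /fine_cvgP[_ /cvgrPdist_lt /(_ _ eta0)]; apply: filterS => k /=.
rewrite sub0r normrN ger0_norm ?fine_ge0// => Pk.
set E := (X in P X) in Pk.
have mE : measurable E.
  apply: measurable_set_ler => //.
  apply: measurableT_comp => //; apply: measurable_funB; last exact: mZ.
  under eq_fun do rewrite partition_sum_dyad.
  apply: measurable_sum_nat => j /andP[_ jn]; apply: mh; apply: dyad_in_ab.
    by rewrite (leq_trans (ltnW jn))// expnD leq_mul2r ni orbT.
  by rewrite (leq_trans jn)// expnD leq_mul2r ni orbT.
exists E; split => //.
  by rewrite -[P E]fineK ?fin_num_measure// lee_fin ltW.
move=> w; rewrite /E/= partition_sum_dyad => /negP; rewrite -ltNge; exact: ltW.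
Qed.


(** On each path the total variation bounds all dyadic variations. Only the latter, countably many,
    have to be measurable for [likely_nonincreasing]. *)
Lemma bounded_variation_dyadic Y : measurable_process a b Y ->
  {ae P, forall w, bounded_variation a b (fun t => Y t w)} ->
  OP P (fun n w => \sum_(0 <= j < 2 ^ n) `|Y (tau n j.+1) w - Y (tau n j) w|).
Proof.
move=> mY bvY eta eta0.
pose V n w := \sum_(0 <= j < 2 ^ n) `|Y (tau n j.+1) w - Y (tau n j) w|.
have mV n : measurable_fun setT (V n).
  apply: measurable_sum_nat => j /andP[_ jn]; apply: measurableT_comp => //.
  by apply: measurable_funB; apply: mY; apply: dyad_in_ab => //; exact: ltnW.
pose B (K : nat) := \bigcup_n [set w | K%:R < V n w].
have mB K : measurable (B K).
  by apply: bigcupT_measurable => n; exact: measurable_set_ltr.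
have dB K : B K.+1 `<=` B K.
  by move=> w [n _ /= h]; exists n => //=; rewrite (lt_trans _ h)// ltr_nat.
have aeB : {ae P, forall w, exists K, ~ B K w}.
  apply: filterS bvY => w.
  move=> /(bounded_variationl (ltW at_) tb)[K hK].
  exists (Num.truncn K).+1 => -[n _] /=; rewrite ltNge => /negP; apply.
  rewrite (le_trans _ (ltW (truncnS_gt _)))//; apply: hK.
  have -> : V n w = variation a t (fun t => Y t w) (dyad_seq a t n (2 ^ n)).
    by rewrite variation_dyad.
  apply: variations_variation.
  by have := dyad_seq_partition at_ n (2 ^ n); rewrite dyad_last.
have [K hK] := likely_nonincreasing mB dB aeB eta0.
exists (K%:R + 1); first by rewrite ltr_wpDl.
near=> n; apply: likelyS hK => // w nB.
rewrite ger0_norm ?sumr_ge0// leNgt; apply/negP => h; apply: nB; exists n => //=.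
by rewrite (lt_trans _ h)// ltrDl.
Unshelve. all: end_near. Qed.


End dyadic_processes.

(** * Normal moments and independence *)

Section normal_moments.
Context {R : realType}.
Local Notation mu := (@lebesgue_measure R).
Local Open Scope ereal_scope.

(** The Radon-Nikodym derivative of [normal_prob m s] agrees almost everywhere with
    [normal_pdf m s], as both have the same integral over every measurable set. *)
Lemma ge0_integral_normal_prob (m s : R) (f : R -> \bar R) :
  (forall x, 0 <= f x) -> measurable_fun setT f ->
  \int[normal_prob m s]_x f x = \int[mu]_x (f x * (normal_pdf m s x)%:E).
Proof.
move=> f0 mf; have dom := normal_prob_dominates m s.
rewrite -(Radon_Nikodym_SigmaFinite.change_of_variables dom f0)//.
apply: ae_eq_integral => //.
- apply: emeasurable_funM => //.
  by apply: (measurable_int mu); exact: (Radon_Nikodym_SigmaFinite.f_integrable dom).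
- apply: emeasurable_funM => //; apply/measurable_EFinP.
  exact: measurable_normal_pdf.
- apply: ae_eqe_mul2l => /=; apply: integral_ae_eq => //.
  + exact: (Radon_Nikodym_SigmaFinite.f_integrable dom).
  + by apply/measurable_EFinP; exact: measurable_normal_pdf.
  + by move=> E _ mE; rewrite -(Radon_Nikodym_SigmaFinite.f_integral dom).
Qed.

(** Half of the Gaussian decay absorbs the factor [x ^+ 2], and the other half is a Gaussian of
    doubled variance, so the second moment is bounded without integration by parts. The constant 8
    is [2 * 2 * 2]: from [x ^+ 2 = - 2 * s ^+ 2 * e], from [- e <= 2 * expR (- e / 2)], and from the
    ratio of the peaks, bounded by 2. It is not sharp, but any constant will do. *)
Lemma normal_pdf_sqr_le (s x : R) : (0 < s)%R ->
  (x ^+ 2 * normal_pdf 0 s x <= 8 * s ^+ 2 * normal_pdf 0 (Num.sqrt 2 * s) x)%R.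
Proof.
move=> s0; have s20 : (0 < Num.sqrt 2 * s)%R by rewrite mulr_gt0 ?sqrtr_gt0.
rewrite !normal_pdfE ?gt_eqF// /normal_fun !subr0.
set p := normal_peak s; set p' := normal_peak _.
have p0 : (0 < p)%R by rewrite normal_peak_gt0// gt_eqF.
have p'0 : (0 < p')%R by rewrite normal_peak_gt0// gt_eqF.
have pp' : (p <= 2 * p')%R.
  have q0 (r : R) : (0 < r)%R -> (0 < Num.sqrt (r ^+ 2 * pi *+ 2))%R.
    by move=> r0; rewrite sqrtr_gt0 mulrn_wgt0// mulr_gt0 ?pi_gt0// exprn_gt0.
  rewrite /p /p' /normal_peak ler_pdivlMr ?q0// mulrC ler_pdivrMr ?q0//.
  rewrite -[X in (_ <= X * _)%R]ger0_norm// -sqrtr_sqr -sqrtrM ?sqr_ge0//.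
  rewrite ler_sqrt; last by rewrite mulr_ge0// ?sqr_ge0// mulrn_wge0// mulr_ge0 ?pi_ge0// sqr_ge0.
  rewrite exprMn sqr_sqrtr//.
  have : (0 <= s ^+ 2 * pi)%R by rewrite mulr_ge0 ?pi_ge0// sqr_ge0.
  rewrite -(mulrA 2%R); move: (s ^+ 2 * pi)%R => y y0.
  have -> : (2 ^+ 2 * (y *+ 2) = (2 * y) *+ 2 * 2 :> R)%R by ring.
  by rewrite ler_peMr ?ler1n// mulrn_wge0// mulr_ge0.
have {}pp' := ler_wpM2r (expR_ge0 (- x ^+ 2 / (s ^+ 2 *+ 2))) pp'.
have -> : (- x ^+ 2 / ((Num.sqrt 2 * s) ^+ 2 *+ 2) = - x ^+ 2 / (s ^+ 2 *+ 2) / 2)%R.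
  by rewrite exprMn sqr_sqrtr//; field; rewrite gt_eqF.
set e := (- x ^+ 2 / (s ^+ 2 *+ 2))%R in pp' *.
have x2 : (x ^+ 2 = - (2 * s ^+ 2 * e))%R.
  by rewrite /e; field; rewrite gt_eqF.
have ee : (- e <= 2 * expR (- e / 2))%R.
  by have := expR_ge1Dx (- e / 2); lra.
have -> : expR (e / 2) = (expR e * expR (- e / 2))%R.
  by rewrite -expRD; congr expR; field.
rewrite x2.
have s2 : (0 < s ^+ 2)%R by rewrite exprn_gt0.
apply: (@le_trans _ _ (2 * s ^+ 2 * (2 * expR (- e / 2)) * (p * expR e)))%R.
  rewrite ler_wpM2r//; first by rewrite mulr_ge0 ?expR_ge0// ltW.
  by rewrite -mulrN ler_wpM2l// mulr_ge0// ltW.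
have -> : (8 * s ^+ 2 * (p' * (expR e * expR (- e / 2))) =
  2 * s ^+ 2 * (2 * expR (- e / 2)) * (2 * p' * expR e))%R by ring.
by rewrite ler_wpM2l// mulr_ge0// mulr_ge0 ?expR_ge0// ltW.
Qed.


Lemma ge0_integralT_oppr (f : R -> R) : (forall x, (0 <= f x)%R) -> continuous f ->
  \int[mu]_x (f (- x)%R)%:E = \int[mu]_x (f x)%:E.
Proof.
move=> f0 cf.
have half (g : R -> R) : (forall x, (0 <= g x)%R) -> continuous g ->
    \int[mu]_x (g x)%:E = \int[mu]_(x in `[0%R, +oo[) (g (- x)%R)%:E +
      \int[mu]_(x in `[0%R, +oo[) (g x)%:E.
  move=> g0 cg.
  have mg : measurable_fun [set: R] g by exact: continuous_measurable_fun.
  rewrite -(setUv [set` `]-oo, 0%R[]) ge0_integral_setU//=; last 4 first.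
    exact: measurableC.
    by apply/measurable_EFinP; rewrite setUv.
    by move=> x _; rewrite lee_fin.
    exact/disj_setPCl.
  rewrite setCitvl; congr (_ + _).
  (* Closing the half line at 0 is free for Lebesgue measure and fits the substitution rule. *)
  rewrite integral_itv_bndo_bndc; last exact/measurable_EFinP/measurable_funTS.
  rewrite -{1}oppr0 ge0_integration_by_substitutionNy//.
  exact: continuous_subspaceT.
rewrite (half (f \o -%R))//=; last first.
  by move=> x; apply: continuous_comp; [exact: oppr_continuous | exact: cf].
rewrite (half f)// addeC; congr (_ + _).
by apply: eq_integral => x _; rewrite opprK.
Qed.


Lemma normal_prob_sqr_le (s : R) : (0 < s)%R ->
  \int[normal_prob 0 s]_x (x ^+ 2)%:E <= (8 * s ^+ 2)%:E.
Proof.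
move=> s0; rewrite ge0_integral_normal_prob; last 2 first.
- by move=> x; rewrite lee_fin sqr_ge0.
- by apply/measurable_EFinP; exact: measurable_funX.
apply: (@le_trans _ _ (\int[mu]_x
    ((8 * s ^+ 2)%:E * (normal_pdf 0 (Num.sqrt 2 * s) x)%:E))).
  apply: ge0_le_integral => //.
  - by move=> x _; rewrite mule_ge0// lee_fin ?sqr_ge0 ?normal_pdf_ge0.
  - apply: emeasurable_funM; apply/measurable_EFinP; last exact: measurable_normal_pdf.
    exact: measurable_funX.
  - apply: emeasurable_funM => //; apply/measurable_EFinP; exact: measurable_normal_pdf.
  - by move=> x _; rewrite -!EFinM lee_fin normal_pdf_sqr_le.
rewrite ge0_integralZl//.
- by rewrite integral_normal_pdf mule1.
- by apply/measurable_EFinP; exact: measurable_normal_pdf.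
- by move=> x _; rewrite lee_fin normal_pdf_ge0.
- by rewrite lee_fin mulr_ge0// sqr_ge0.
Qed.

Lemma integrable_of_sqr d (T : measurableType d) (m : {measure set T -> \bar R})
    (f : T -> R) : m setT < +oo -> measurable_fun setT f ->
  \int[m]_x (f x ^+ 2)%:E < +oo -> m.-integrable setT (EFin \o f).
Proof.
move=> m1 mf f2; apply/integrableP; split; first exact/measurable_EFinP.
apply: (@le_lt_trans _ _ (\int[m]_x (1 + (f x ^+ 2)%:E))).
  apply: ge0_le_integral => //.
  - by apply: measurableT_comp => //; exact/measurable_EFinP.
  - apply: emeasurable_funD => //; apply/measurable_EFinP.
    exact: measurable_funX.
  - move=> x _; rewrite -EFinD lee_fin -real_normK ?num_real//.
    by have := normr_ge0 (f x); nra.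
rewrite ge0_integralD//; first last.
- by apply/measurable_EFinP; exact: measurable_funX.
- by move=> x _; rewrite lee_fin sqr_ge0.
by rewrite integral_cst// mul1e lte_add_pinfty.
Qed.

(** The density is even, so the positive and the negative part of the identity have the same
    integral. They may be subtracted because the second moment makes this common value finite. *)
Lemma normal_prob_mean0 (s : R) : (0 < s)%R ->
  \int[normal_prob 0 s]_x x%:E = 0.
Proof.
move=> s0; pose p x := Num.max x (0 : R)%R.
have mp : measurable_fun setT p by apply: measurable_maxr.
have cp : continuous p.
  by move=> x; apply: (@continuous_max _ _ id (cst 0%R)) => //; exact: cvg_cst.
pose g x := (p x * normal_pdf 0 s x)%R.
have g0 x : (0 <= g x)%R by rewrite mulr_ge0 ?normal_pdf_ge0// le_max lexx orbT.
have cg : continuous g.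
  by move=> x; apply: continuousM; [exact: cp | apply: continuous_normal_pdf; rewrite gt_eqF].
have gN x : (p (- x) * normal_pdf 0 s x)%R = g (- x)%R.
  rewrite /g; congr (_ * _)%R; rewrite !normal_pdfE ?gt_eqF//.
  by rewrite /normal_fun !subr0 sqrrN.
have H1 : \int[normal_prob 0 s]_x (p x)%:E = \int[mu]_x (g x)%:E.
  rewrite ge0_integral_normal_prob//.
  - by move=> x; rewrite lee_fin le_max lexx orbT.
  - exact/measurable_EFinP.
have H2 : \int[normal_prob 0 s]_x (p (- x)%R)%:E = \int[mu]_x (g x)%:E.
  rewrite ge0_integral_normal_prob//.
  - rewrite -(ge0_integralT_oppr g0 cg).
    by apply: eq_integral => x _; rewrite -EFinM gN.
  - by move=> x; rewrite lee_fin le_max lexx orbT.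
  - by apply/measurable_EFinP; apply: measurableT_comp => //; exact: oppr_measurable.
have fin : \int[mu]_x (g x)%:E < +oo.
  rewrite -H1; have : (normal_prob 0 s).-integrable setT (EFin \o id).
    apply: integrable_of_sqr => //.
      by rewrite (le_lt_trans (probability_le1 _ _))// ltry.
    by rewrite (le_lt_trans (normal_prob_sqr_le s0))// ltry.
  move=> /integrableP[_]; apply: le_lt_trans; apply: ge0_le_integral => //.
  - by move=> x _; rewrite lee_fin le_max lexx orbT.
  - exact/measurable_EFinP.
  - by apply: measurableT_comp => //; exact/measurable_EFinP.
  - by move=> x _ /=; rewrite lee_fin ge_max ler_norm normr_ge0.
have g0' : 0 <= \int[mu]_x (g x)%:E by apply: integral_ge0 => x _; rewrite lee_fin.
rewrite integralE.
have -> : (fun x : R => x%:E)^\+ = (fun x => (p x)%:E).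
  by apply/funext => x; rewrite funeposE /p EFin_max.
have -> : (fun x : R => x%:E)^\- = (fun x => (p (- x)%R)%:E).
  by apply/funext => x; rewrite funenegE /p EFin_max.
by rewrite H1 H2 subee// ge0_fin_numE.
Qed.

End normal_moments.

Section independence.
Context (dO : measure_display) (Omega : measurableType dO) (R : realType).
Variable P : probability Omega R.
Local Open Scope ereal_scope.

(** The product rule on rectangles identifies the joint law of [G] and [D] with the product of their
    laws. Fubini then leaves the mean of [D] as a factor of every inner integral. *)
Lemma integralM_independent_mean0 (G D : Omega -> R) :
  measurable_fun setT G -> measurable_fun setT D ->
  (forall A B, measurable A -> measurable B ->
    P (G @^-1` A `&` D @^-1` B) = P (G @^-1` A) * P (D @^-1` B)) ->
  P.-integrable setT (EFin \o D) ->
  P.-integrable setT (fun w => (G w * D w)%:E) ->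
  \int[P]_w (D w)%:E = 0 -> \int[P]_w (G w * D w)%:E = 0.
Proof.
move=> mG mD GD iD iGD D0.
pose J w := (G w, D w).
have mJ : measurable_fun setT J by exact: measurable_fun_pair.
pose Gm : {mfun Omega >-> R} := HB.pack G (isMeasurableFun.Build _ _ _ _ _ mG).
pose Dm : {mfun Omega >-> R} := HB.pack D (isMeasurableFun.Build _ _ _ _ _ mD).
pose Jm : {mfun Omega >-> (R * R)%type} :=
  HB.pack J (isMeasurableFun.Build _ _ _ _ _ mJ).
pose m1 := distribution P Gm; pose m2 := distribution P Dm.
pose mJ' := distribution P Jm.
pose f (z : R * R) := (z.1 * z.2)%:E.
have mf : measurable_fun setT f.
  by apply/measurable_EFinP; exact: measurable_funM.
have E : forall X : set (R * R), measurable X -> (m1 \x m2) X = mJ' X.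
  by apply: product_measure_unique => A B mA mB; rewrite /m1 /m2 /mJ' /= -GD.
have iJ : (m1 \x m2).-integrable setT f.
  apply/integrableP; split => //.
  rewrite (eq_measure_integral mJ'); last by move=> A mA _; exact: E.
  rewrite ge0_integral_distribution//; last exact: measurableT_comp.
  by case/integrableP : iGD.
have -> : \int[P]_w (G w * D w)%:E = \int[mJ']_z f z.
  by rewrite integral_distribution.
rewrite (eq_measure_integral (m1 \x m2)%E); last by move=> A mA _; apply/esym/E.
rewrite -integral12_prod_meas1// /fubini_F.
have iD' : m2.-integrable setT (EFin \o id).
  by apply: integrable_pushforward => //; apply/measurable_EFinP.
apply: integral0_eq => x _.
under eq_integral do rewrite /f /= EFinM.
rewrite integralZl//.
rewrite [X in _ * X](_ : _ = 0) ?mule0//.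
by rewrite -D0 /m2 integral_distribution.
Qed.

End independence.

(** * Discrete Ito isometry *)

Lemma ler_normM_sqrD (R : realFieldType) (x y : R) :
  `|x * y| <= x ^+ 2 + y ^+ 2.
Proof.
rewrite normrM -(real_normK (num_real x)) -(real_normK (num_real y)).
by move: (normr_ge0 x) (normr_ge0 y); move: `|x| `|y| => u v u0 v0; nra.
Qed.

Section sub_sigma_algebra.
Context (Omega : pointedType) (R : realType).
Variable S : set (set Omega).
Hypothesis sS : sigma_algebra setT S.
Implicit Types G H : Omega -> R.

Definition sub_measurable G := forall B, measurable B -> S (G @^-1` B).

(** The classes of a filtration are bare sets of sets. Passing to [g_sigma_algebraType S] gives
    access to the closure properties of measurable functions. *)
Lemma sub_measurableP G :
  sub_measurable G <-> measurable_fun setT (G : g_sigma_algebraType S -> R).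
Proof.
have SE : <<s S >> = S by exact: sigma_algebra_id.
split=> [h _ B mB|h B mB]; first by rewrite setTI /measurable/= SE; exact: h.
by have := h measurableT B mB; rewrite setTI /measurable/= SE.
Qed.

End sub_sigma_algebra.

Section ito_driver.
Context (dO : measure_display) (Omega : measurableType dO) (R : realType).
Variable P : probability Omega R.
Variables (a b : R) (F : R -> set (set Omega)).
Hypothesis hF : filtration a b F.
Implicit Types (Y Z : R -> Omega -> R).

Lemma sub_measurable_mono s t (G : Omega -> R) : s \in `[a, b] -> t \in `[a, b] ->
  s <= t -> sub_measurable (F s) G -> sub_measurable (F t) G.
Proof. by case: hF => _ _ mono sab tab st mG B mB; apply: (mono s t) => //; exact: mG. Qed.

Lemma sub_measurable_fun t (G : Omega -> R) : t \in `[a, b] ->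
  sub_measurable (F t) G -> measurable_fun setT G.
Proof. by case: hF => _ sub _ tab mG _ B mB; rewrite setTI; apply: (sub t) => //; exact: mG. Qed.

Lemma adapted_measurable Y : adapted a b F Y -> measurable_process a b Y.
Proof. by move=> aY u uab; apply: (sub_measurable_fun uab) => B mB; exact: aY. Qed.

(* The consequence of the discrete Ito isometry that also holds for the driver
   [Z t = t]. *)
Definition ito_driver Z (C : R) :=
  forall (s : nat -> R) (H : nat -> Omega -> R) (theta : R) (m n : nat),
  (m <= n)%N ->
  (forall j, (m <= j <= n)%N -> s j \in `[a, b]) ->
  (forall j, (m <= j < n)%N -> s j < s j.+1) ->
  (forall j, (m <= j < n)%N -> sub_measurable (F (s j)) (H j)) ->
  (forall j, (m <= j < n)%N -> forall w, `|H j w| <= theta) ->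
  (\int[P]_w ((\sum_(m <= j < n) H j w * (Z (s j.+1) w - Z (s j) w)) ^+ 2)%:E
     <= (C * theta ^+ 2 * (s n - s m))%:E)%E.

(** The sum is at most [theta * (s n - s m)] in absolute value. In its square one factor [s n - s m]
    is bounded by [b - a], which is the constant. *)
Lemma time_ito_driver : ito_driver (fun t _ => t) (b - a).
Proof.
move=> s H theta m n mn sab slt mH Hle.
have ub (w : Omega) : `|\sum_(m <= j < n) H j w * (s j.+1 - s j)| <= theta * (s n - s m).
  have -> : theta * (s n - s m) = \sum_(m <= j < n) theta * (s j.+1 - s j).
    by rewrite -mulr_sumr telescope_sumr.
  rewrite (le_trans (ler_norm_sum _ _ _))// !big_nat ler_sum// => j jmn.
  have sj : 0 <= s j.+1 - s j by rewrite subr_ge0 ltW// slt.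
  by rewrite normrM (ger0_norm sj) ler_wpM2r// Hle.
have smn : s m <= s n.
  elim: n mn sab slt {mH Hle ub} => [|n IH]; first by rewrite leqn0 => /eqP ->.
  rewrite leq_eqVlt => /predU1P[-> //|]; rewrite ltnS => mn sab slt.
  apply: le_trans (IH mn _ _) (ltW (slt n _)) => [j /andP[mj jn]|j /andP[mj jn]|].
  - by apply: sab; rewrite mj ltnW.
  - by apply: slt; rewrite mj ltnW.
  - by rewrite mn leqnn.
have := sab m; have := sab n; rewrite !leqnn mn /= => /(_ isT) + /(_ isT).
rewrite !in_itv/= => /andP[_ snb] /andP[asm _].
apply: (@le_trans _ _ (\int[P]_w ((theta * (s n - s m)) ^+ 2)%:E)%E).
  apply: ge0_le_integral => //.
  - by move=> w _; rewrite lee_fin sqr_ge0.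
  - apply/measurable_EFinP; apply: measurable_funX; apply: measurable_sum_nat => j jmn.
    apply: measurable_funM => //; apply: sub_measurable_fun (mH j jmn); apply: sab.
    by case/andP: jmn => -> /ltnW.
  - move=> w _; rewrite lee_fin -[leLHS]real_normK ?num_real//.
    by rewrite ler_pXn2r ?nnegrE//; exact: le_trans (ub w).
have -> : (\int[P]_w ((theta * (s n - s m)) ^+ 2)%:E =
    ((theta * (s n - s m)) ^+ 2)%:E)%E.
  have P1 : P setT = 1%E by exact: probability_setT.
  by rewrite integral_cst//= -[RHS]mule1; congr (_ * _)%E.
rewrite lee_fin -subr_ge0.
have -> : (b - a) * theta ^+ 2 * (s n - s m) - (theta * (s n - s m)) ^+ 2 =
  theta ^+ 2 * (s n - s m) * ((b - s n) + (s m - a)) by ring.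
by do 2?apply: mulr_ge0; rewrite ?sqr_ge0 ?subr_ge0//; lra.
Qed.

Lemma brownian_increment_moments Z s t : wiener_process P a b Z ->
  s \in `[a, b] -> t \in `[a, b] -> s < t ->
  [/\ measurable_fun setT (fun w => Z t w - Z s w),
      (\int[P]_w ((Z t w - Z s w) ^+ 2)%:E <= (8 * (t - s))%:E)%E,
      P.-integrable setT (fun w => (Z t w - Z s w)%:E) &
      (\int[P]_w (Z t w - Z s w)%:E = 0)%E].
Proof.
move=> [mZ _ law _] sab tab st.
pose D w := Z t w - Z s w.
have mD : measurable_fun setT D by apply: measurable_funB; exact: mZ.
pose Dm : {mfun Omega >-> R} := HB.pack D (isMeasurableFun.Build _ _ _ _ _ mD).
pose sg := Num.sqrt (t - s).
have sg0 : 0 < sg by rewrite sqrtr_gt0 subr_gt0.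
(* Written as the law of the identity, the normal law lives on the same measurable type as the law
   of [D], and [eq_measure_integral] can compare the two. *)
pose idT : measurableTypeR R -> R := idfun.
have mid : measurable_fun setT idT by exact: (@measurable_id _ _ setT).
pose idm : {mfun measurableTypeR R >-> R} :=
  HB.pack idT (isMeasurableFun.Build _ _ _ _ _ mid).
pose N : probability (measurableTypeR R) R := normal_prob 0 sg.
have lawE : forall A, measurable A -> A `<=` setT ->
    distribution P Dm A = distribution N idm A.
  by move=> A mA _; exact: law.
have D2 : (\int[P]_w (D w ^+ 2)%:E <= (8 * (t - s))%:E)%E.
  have -> : (\int[P]_w (D w ^+ 2)%:E =
      \int[distribution P Dm]_x (x ^+ 2)%:E)%E.
    rewrite ge0_integral_distribution//; last by move=> x; rewrite lee_fin sqr_ge0.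
    by apply/measurable_EFinP; exact: measurable_funX.
  rewrite (eq_measure_integral (distribution N idm))//.
  rewrite ge0_integral_distribution//; first last.
  - by move=> x; rewrite lee_fin sqr_ge0.
  - by apply/measurable_EFinP; exact: measurable_funX.
  by rewrite (le_trans (normal_prob_sqr_le sg0))// sqr_sqrtr// subr_ge0 ltW.
have iD : P.-integrable setT (EFin \o D).
  apply: integrable_of_sqr => //.
    by rewrite (le_lt_trans (probability_le1 _ _))// ltry.
  by rewrite (le_lt_trans D2)// ltry.
split => //.
have -> : (\int[P]_w (D w)%:E = \int[distribution P Dm]_x x%:E)%E.
  by rewrite integral_distribution//; apply/measurable_EFinP.
rewrite (eq_measure_integral (distribution N idm))// integral_distribution//.
- exact: normal_prob_mean0.
- apply: integrable_of_sqr => //.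
    by rewrite (le_lt_trans (probability_le1 _ _))// ltry.
  by rewrite (le_lt_trans (normal_prob_sqr_le sg0))// ltry.
Qed.

(** Induction on [n]: in the square of [U n + H n * D] the factor [U n * H n] of the cross term is
    known at time [s n], and the increment [D] is independent of that past with mean 0. The constant
    8 is the one of the normal second moment. *)
Lemma brownian_ito_driver Z : wiener_process P a b Z -> adapted a b F Z ->
  (forall s t, s \in `[a, b] -> t \in `[a, b] -> s < t ->
    forall A B, F s A -> measurable B ->
    P (A `&` (fun w => Z t w - Z s w) @^-1` B) =
    (P A * P ((fun w => (Z t w - Z s w)%R) @^-1` B))%E) ->
  ito_driver Z 8.
Proof.
move=> wZ aZ indep s H theta m n mn sab slt mH Hle.
pose U n w := \sum_(m <= j < n) H j w * (Z (s j.+1) w - Z (s j) w).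
have sigF u : u \in `[a, b] -> sigma_algebra setT (F u) by case: hF => h _ _; exact: h.
(* Measurability of the partial sum with respect to the past is carried along, since independence in
   the cross term rests on it. *)
suff : sub_measurable (F (s n)) (U n) /\
    (\int[P]_w (U n w ^+ 2)%:E <= (8 * theta ^+ 2 * (s n - s m))%:E)%E by case.
elim: n mn sab slt mH Hle => [|n IH].
  rewrite leqn0 => /eqP m0 sab _ _ _.
  have U0 : U 0%N = cst 0 by apply/funext => w; rewrite /U m0 big_geq.
  split; last first.
    under eq_integral do rewrite U0 expr0n.
    by rewrite integral0 lee_fin m0 subrr mulr0.
  rewrite U0; have /sigF sF : s 0%N \in `[a, b] by apply: sab; rewrite m0.
  by apply/(sub_measurableP sF); exact: measurable_cst.
rewrite leq_eqVlt => /predU1P[<- sab _ _ _|].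
  have U0 : U m = cst 0 by apply/funext => w; rewrite /U big_geq.
  split; last first.
    under eq_integral do rewrite U0 expr0n.
    by rewrite integral0 lee_fin subrr mulr0.
  rewrite U0; have /sigF sF : s m \in `[a, b] by apply: sab; rewrite leqnn.
  by apply/(sub_measurableP sF); exact: measurable_cst.
rewrite ltnS => mn sab slt mH Hle.
have [||||mU U2] := IH mn.
- by move=> j /andP[mj jn]; apply: sab; rewrite mj leqW.
- by move=> j /andP[mj jn]; apply: slt; rewrite mj ltnW.
- by move=> j /andP[mj jn]; apply: mH; rewrite mj ltnW.
- by move=> j /andP[mj jn]; apply: Hle; rewrite mj ltnW.
have nab : s n \in `[a, b] by apply: sab; rewrite mn leqnSn.
have n1ab : s n.+1 \in `[a, b] by apply: sab; rewrite leqnn leqW.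
have snn : s n < s n.+1 by apply: slt; rewrite mn leqnn.
have mHn : sub_measurable (F (s n)) (H n) by apply: mH; rewrite mn leqnn.
have Hlen w : `|H n w| <= theta by apply: Hle; rewrite mn leqnn.
pose D w := Z (s n.+1) w - Z (s n) w.
have [mD D2 iD D0] := brownian_increment_moments wZ nab n1ab snn.
have US w : U n.+1 w = U n w + H n w * D w by rewrite /U big_nat_recr.
have sn := sigF _ nab; have sn1 := sigF _ n1ab.
have mUH : sub_measurable (F (s n)) (fun w => U n w * H n w).
  apply/(sub_measurableP sn); apply: measurable_funM; exact/(sub_measurableP sn).
split.
  have -> : U n.+1 = (fun w => U n w + H n w * (Z (s n.+1) w - Z (s n) w)).
    by apply/funext => w; exact: US.
  have up := sub_measurable_mono nab n1ab (ltW snn).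
  apply/(sub_measurableP sn1); apply: measurable_funD.
    by apply/(sub_measurableP sn1); exact: up.
  apply: measurable_funM; first by apply/(sub_measurableP sn1); exact: up.
  apply: measurable_funB; apply/(sub_measurableP sn1).
    by move=> B mB; exact: aZ.
  by apply: up => B mB; exact: aZ.
have mUn := sub_measurable_fun nab mU; have mHn' := sub_measurable_fun nab mHn.
have P1 : (P setT < +oo)%E by rewrite (le_lt_trans (probability_le1 _ _))// ltry.
pose HD w := H n w * D w.
have mHD : measurable_fun setT HD by exact: measurable_funM.
(* The sign of [theta] is read off the bound on [H n] at a point of [Omega]. *)
have theta0 (w : Omega) : 0 <= theta by apply: le_trans (Hlen w).
have HD2 : (\int[P]_w (HD w ^+ 2)%:E <= (8 * theta ^+ 2 * (s n.+1 - s n))%:E)%E.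
  apply: (@le_trans _ _ (\int[P]_w ((theta ^+ 2)%:E * (D w ^+ 2)%:E))%E).
    apply: ge0_le_integral => //.
    - by move=> w _; rewrite lee_fin sqr_ge0.
    - by apply/measurable_EFinP; exact: measurable_funX.
    - apply: emeasurable_funM => //; apply/measurable_EFinP; exact: measurable_funX.
    - move=> w _; rewrite -EFinM lee_fin exprMn ler_wpM2r ?sqr_ge0//.
      by rewrite -[leLHS]real_normK ?num_real// ler_pXn2r ?nnegrE//; exact: (theta0 w).
  rewrite ge0_integralZl//.
  - rewrite (mulrC 8) -mulrA [leRHS]EFinM; apply: lee_wpmul2l => //.
    by rewrite lee_fin sqr_ge0.
  - by apply/measurable_EFinP; exact: measurable_funX.
  - by move=> w _; rewrite lee_fin sqr_ge0.
  - by rewrite lee_fin sqr_ge0.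
have iUU : P.-integrable setT (fun w => (U n w ^+ 2)%:E).
  apply/integrableP; split; first by apply/measurable_EFinP; exact: measurable_funX.
  under eq_integral do rewrite gee0_abs ?lee_fin ?sqr_ge0//.
  by rewrite (le_lt_trans U2)// ltry.
have iHH : P.-integrable setT (fun w => (HD w ^+ 2)%:E).
  apply/integrableP; split; first by apply/measurable_EFinP; exact: measurable_funX.
  under eq_integral do rewrite gee0_abs ?lee_fin ?sqr_ge0//.
  by rewrite (le_lt_trans HD2)// ltry.
have iUH : P.-integrable setT (fun w => (U n w * H n w * D w)%:E).
  apply: (@le_integrable _ _ _ _ _ _ _ (fun w => (U n w ^+ 2)%:E + (HD w ^+ 2)%:E)%E) => //.
  - by apply/measurable_EFinP; apply: measurable_funM => //; exact: measurable_funM.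
  - move=> w _; rewrite -EFinD /= lee_fin [leRHS]ger0_norm; last by rewrite addr_ge0// sqr_ge0.
    by rewrite -mulrA; exact: ler_normM_sqrD.
  - exact: integrableD.
have cross : (\int[P]_w (U n w * H n w * D w)%:E = 0)%E.
  apply: integralM_independent_mean0 => //.
    exact: measurable_funM.
  by move=> A B mA mB; apply: indep => //; exact: mUH.
have -> : (\int[P]_w (U n.+1 w ^+ 2)%:E = \int[P]_w ((U n w ^+ 2)%:E +
    (2%:E * (U n w * H n w * D w)%:E + (HD w ^+ 2)%:E)))%E.
  apply: eq_integral => w _; rewrite US -EFinM -!EFinD; congr EFin.
  by rewrite /HD; ring.
rewrite integralD//; last first.
  by apply: integrableD => //; exact: integrableZl.
rewrite integralD//; last exact: integrableZl.
rewrite integralZl// cross mule0 add0e.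
have -> : 8 * theta ^+ 2 * (s n.+1 - s m) =
  8 * theta ^+ 2 * (s n - s m) + 8 * theta ^+ 2 * (s n.+1 - s n) by ring.
by rewrite EFinD leeD.
Qed.

End ito_driver.

(** * Riemann sums of the Ito integral *)

Section likely_moment.
Context (dO : measure_display) (Omega : measurableType dO) (R : realType).
Variable P : probability Omega R.

Lemma likely_markov (V : Omega -> R) (v e : R) : measurable_fun setT V ->
  (forall w, 0 <= V w) -> 0 < e -> (\int[P]_w (V w)%:E <= v%:E)%E ->
  likely P (v / e) (fun w => V w <= e).
Proof.
move=> mV V0 e0 Vv.
pose Vm : {mfun Omega >-> R} := HB.pack V (isMeasurableFun.Build _ _ _ _ _ mV).
have := @markov _ _ _ P Vm id e e0 (@measurable_id _ _ _) (fun r h => h)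
  (fun x y _ _ h => h).
rewrite unlock => mk.
exists [set w | e <= V w]; split; first exact: measurable_set_ler.
  rewrite mulrC EFinM lee_pdivlMl// (le_trans _ Vv)//.
  have -> : [set w | e <= V w] = [set w | (e%:E <= `|(Vm w)%:E|)%E].
    by apply/funext => w /=; rewrite lee_fin ger0_norm.
  rewrite (le_trans mk)// le_eqVlt; apply/orP; left; apply/eqP.
  by apply: eq_integral => w _ /=; rewrite ger0_norm.
by move=> w /= /negP; rewrite -ltNge; exact: ltW.
Qed.

End likely_moment.

(** An adapted cut-off: it bounds the integrand everywhere, as [ito_driver] requires, and does
    nothing on the event where the integrand stays below [theta]. *)
Definition trunc {R : realType} (theta x : R) : R := if `|x| <= theta then x else 0.

Lemma measurable_trunc (R : realType) (theta : R) : measurable_fun setT (trunc theta).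
Proof.
apply: measurable_fun_ifT => //; apply: measurable_realfun.measurable_fun_ler => //.
Qed.

Lemma trunc_le (R : realType) (theta x : R) : 0 <= theta -> `|trunc theta x| <= theta.
Proof. by move=> t0; rewrite /trunc; case: ifP => //; rewrite normr0. Qed.

Definition dyad_incr (Omega : Type) (R : realType) (a t : R) (Y : R -> Omega -> R) n j w :=
  Y (dyad a t n j.+1) w - Y (dyad a t n j) w.

Section ito_error.
Context (dO : measure_display) (Omega : measurableType dO) (R : realType).
Variable P : probability Omega R.
Variables (a b t : R) (F : R -> set (set Omega)).
Hypotheses (hF : filtration a b F) (at_ : a < t) (tb : t <= b).
Local Notation tau := (dyad a t).
Local Notation incr := (dyad_incr a t).

Let ab : a <= b. Proof. exact: le_trans (ltW at_) tb. Qed.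
Let tau_in n j : (j <= 2 ^ n)%N -> tau n j \in `[a, b].
Proof. exact: dyad_in_ab. Qed.

Lemma adapted_opP_OP Y : adapted a b F Y -> continuous_process P a b Y ->
  forall u, u \in `[a, b] -> OP P (fun _ => Y u).
Proof.
move=> aY cY u uab eta eta0.
have [K K0 hK] := continuous_process_bounded ab (adapted_measurable hF aY) cY eta0.
exists K => //; near=> k; apply: likelyS hK => // w; exact.
Unshelve. all: end_near. Qed.

Variables (c Z J : R -> Omega -> R) (C : R).
Hypotheses (C0 : 0 < C) (iZ : ito_driver P a b F Z C) (aZ : adapted a b F Z).
Hypotheses (ac : adapted a b F c) (cc : continuous_process P a b c).
Hypothesis (hJ : ito_integral P F a b c Z J).

Definition ito_err n j w := incr J n j w - c (tau n j) w * incr Z n j w.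

(** A discrete stand-in for [ito_err n i]: the limit as [k] grows with [n] and [i] fixed, but a sum
    of adapted terms to which [ito_driver] applies once truncated. *)
Let block n k i w := \sum_(i * 2 ^ k <= j < i.+1 * 2 ^ k)
  (c (tau (n + k) j) w - c (tau n i) w) * incr Z (n + k) j w.

Let block_cvg n i : (i < 2 ^ n)%N ->
  opP P (fun k w => block n k i w - ito_err n i w).
Proof.
move=> ni; have [aJ _ lJ] := hJ.
have mc := adapted_measurable hF ac; have mZ := adapted_measurable hF aZ.
have mJ := adapted_measurable hF aJ.
have lim := limit_dyadic at_ tb lJ _ mJ.
have mh u v : u \in `[a, b] -> v \in `[a, b] ->
    measurable_fun setT (fun w => c u w * (Z v w - Z u w)).
  move=> uab vab; apply: measurable_funM; first exact: mc.
  by apply: measurable_funB; exact: mZ.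
have h1 := lim mh n i.+1 ni; have h0 := opPZ (- 1) (lim mh n i (ltnW ni)).
apply: opP_le (opPD h1 h0) => eta eta0; apply: ae_near_likely => //; apply: aeW => w k.
rewrite le_eqVlt; apply/orP; left; apply/eqP; congr (`|_|).
rewrite (@big_cat_nat _ _ _ (i * 2 ^ k) 0 (i.+1 * 2 ^ k))//=; last first.
  by rewrite leq_mul2r leqnSn orbT.
rewrite /block /ito_err.
have -> : \sum_(i * 2 ^ k <= j < i.+1 * 2 ^ k)
    (c (tau (n + k) j) w - c (tau n i) w) * incr Z (n + k) j w =
  \sum_(i * 2 ^ k <= j < i.+1 * 2 ^ k) c (tau (n + k) j) w * incr Z (n + k) j w -
  c (tau n i) w * incr Z n i w.
  under eq_bigr do rewrite mulrBl.
  rewrite sumrB -mulr_sumr /incr telescope_sumr ?leq_mul2r ?leqnSn ?orbT//.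
  by rewrite !dyad_refine.
by rewrite /incr; ring.
Qed.

Variable y : R -> Omega -> R.
Hypotheses (ay : adapted a b F y) (cy : continuous_process P a b y).

(** [j %/ 2 ^ k] is the coarse interval that contains the fine index [j]. With it the weighted
    blocks of all [i] become one sum over [j], each integrand being known at time
    [tau (n + k) j]. *)
Let G n k j w := y (tau n (j %/ 2 ^ k)) w *
  (c (tau (n + k) j) w - c (tau n (j %/ 2 ^ k)) w).

Let div_le n k j : (j <= 2 ^ (n + k))%N -> (j %/ 2 ^ k <= 2 ^ n)%N.
Proof.
move=> jn; have k0 : (0 < 2 ^ k)%N by rewrite expn_gt0.
by rewrite -[leqRHS](mulnK _ k0) -expnD leq_div2r.
Qed.

Let tau_div_le n k j : tau n (j %/ 2 ^ k) <= tau (n + k) j.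
Proof. by rewrite -(dyad_refine a t n k) dyad_le// leq_trunc_div. Qed.

Let tau_div_dist n k j :
  `|tau (n + k) j - tau n (j %/ 2 ^ k)| <= (t - a) / 2 ^+ n.
Proof.
rewrite ger0_norm ?subr_ge0 ?tau_div_le// -(dyad_step a t n (j %/ 2 ^ k)).
rewrite lerB// -(dyad_refine a t n k) dyad_le//.
by rewrite ltnW// -ltn_divLR ?expn_gt0.
Qed.

Let sub_measurable_trunc_G n k j theta : (j <= 2 ^ (n + k))%N ->
  sub_measurable (F (tau (n + k) j)) (fun w => trunc theta (G n k j w)).
Proof.
move=> jn; have jab := tau_in jn; have dab := tau_in (div_le jn).
have sF : sigma_algebra setT (F (tau (n + k) j)) by case: hF => h _ _; exact: h.
have up Y : adapted a b F Y -> measurable_fun setT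
    (Y (tau n (j %/ 2 ^ k)) : g_sigma_algebraType (F (tau (n + k) j)) -> R).
  move=> aY; apply/(sub_measurableP sF).
  apply: (sub_measurable_mono hF dab jab (tau_div_le n k j)) => B mB; exact: aY.
apply/(sub_measurableP sF); apply: measurableT_comp; first exact: measurable_trunc.
apply: measurable_funM; first exact: up.
apply: measurable_funB; last exact: up.
by apply/(sub_measurableP sF) => B mB; exact: ac.
Qed.

Let trunc_sum theta n k m m' w :=
  \sum_(m <= j < m') trunc theta (G n k j w) * incr Z (n + k) j w.

Let trunc_isometry theta n k m m' : 0 <= theta -> (m <= m' <= 2 ^ (n + k))%N ->
  (\int[P]_w ((trunc_sum theta n k m m' w) ^+ 2)%:E <=
    (C * theta ^+ 2 * (tau (n + k) m' - tau (n + k) m))%:E)%E.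
Proof.
move=> t0 /andP[mm' m'n]; apply: (iZ (s := tau (n + k))
  (H := fun j w => trunc theta (G n k j w))) => //.
- by move=> j /andP[_ jm']; apply: tau_in; exact: leq_trans m'n.
- by move=> j _; exact: dyad_lt.
- move=> j /andP[_ jm']; apply: sub_measurable_trunc_G.
  exact: leq_trans (ltnW jm') m'n.
- by move=> j _ w; exact: trunc_le.
Qed.

Let measurable_trunc_sum theta n k m m' : (m' <= 2 ^ (n + k))%N ->
  measurable_fun setT (trunc_sum theta n k m m').
Proof.
move=> m'n; apply: measurable_sum_nat => j /andP[_ jm'].
have jn := leq_trans jm' m'n.
apply: measurable_funM.
  apply: (sub_measurable_fun hF (tau_in (ltnW jn))).
  exact: sub_measurable_trunc_G (ltnW jn).
by apply: measurable_funB; apply: (adapted_measurable hF aZ); apply: tau_in => //; exact: ltnW.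
Qed.

(** One exceptional event serves all [n], [k] and [j]: [y] is bounded by [K] on it, and [c] varies
    by at most [theta / K] over a coarse interval. This is what allows [k] to be chosen last. *)
Let likely_small theta eta : 0 < theta -> 0 < eta -> exists2 del, 0 < del &
  likely P eta (fun w => forall n k j, (t - a) / 2 ^+ n <= del ->
    (j <= 2 ^ (n + k))%N -> `|G n k j w| <= theta).
Proof.
move=> theta0 eta0; have eta2 : 0 < eta / 2 by rewrite divr_gt0.
have [K K0 hK] := continuous_process_bounded ab (adapted_measurable hF ay) cy eta2.
have tK : 0 < theta / K by rewrite divr_gt0.
have [del del0 hdel] :=
  continuous_process_modulus ab (adapted_measurable hF ac) cc tK eta2.
exists del => //; have := likelyI hK hdel; rewrite -splitr.
apply: likelyS => // w [yK cdel] n k j ndel jn.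
have jab := tau_in jn; have dab := tau_in (div_le jn).
rewrite /G normrM -(divfK (lt0r_neq0 K0) theta) mulrC ler_pM ?yK//.
by apply: cdel => //; exact: le_trans (tau_div_dist _ _ _) ndel.
Qed.

Let block_truncE theta n k i w : (i < 2 ^ n)%N ->
  (forall j, (j <= 2 ^ (n + k))%N -> `|G n k j w| <= theta) ->
  y (tau n i) w * block n k i w =
  trunc_sum theta n k (i * 2 ^ k) (i.+1 * 2 ^ k) w.
Proof.
move=> ni small; rewrite /block /trunc_sum mulr_sumr.
apply: eq_big_nat => j /andP[ij ji].
have ji_ : (j %/ 2 ^ k)%N = i.
  apply/eqP; rewrite eqn_leq -ltnS ltn_divLR ?expn_gt0// ji/=.
  by rewrite leq_divRL ?expn_gt0.
rewrite /trunc small; first by rewrite /G ji_ mulrA.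
by rewrite ltnW// (leq_trans ji)// expnD leq_mul2r ni orbT.
Qed.

Let threshold (e eta : R) : 0 < e -> 0 < eta -> exists2 theta, 0 < theta &
  C * theta ^+ 2 * (t - a) / e <= eta.
Proof.
move=> e0 eta0; have ta : 0 < t - a by rewrite subr_gt0.
pose q := e * eta / (C * (t - a)).
have q0 : 0 < q by rewrite divr_gt0 ?mulr_gt0.
exists (Num.sqrt q); first by rewrite sqrtr_gt0.
rewrite sqr_sqrtr ?(ltW q0)// le_eqVlt; apply/orP; left; apply/eqP.
by rewrite /q; field; rewrite !gt_eqF.
Qed.

(** The blocks of all [i] form a single truncated sum at level [n + k], whose second moment is at
    most [C * theta ^+ 2 * (t - a)] whatever [k] is. The modulus of continuity lets [theta] be as
    small as desired once [n] is large. *)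
Lemma ito_err_weighted :
  opP P (fun n w => \sum_(0 <= i < 2 ^ n) y (tau n i) w * ito_err n i w).
Proof.
move=> e eta e0 eta0.
have eta3 : 0 < eta / 3 by rewrite divr_gt0.
have e2 : 0 < e / 2 by rewrite divr_gt0.
have e22 : 0 < (e / 2) ^+ 2 by rewrite exprn_gt0.
have [theta theta0 thetaE] := threshold e22 eta3.
have [del del0 small] := likely_small theta0 eta3.
have nstep := near_dyad_step at_ del0.
near=> n.
have hn : (t - a) / 2 ^+ n <= del by near: n.
(* [k] depends on [n]: the blocks converge without a rate, but there are only [2 ^ n] of them. *)
have [k hk] : exists k, likely P (eta / 3) (fun w =>
    `|\sum_(i < 2 ^ n) y (tau n i) w * (block n k i w - ito_err n i w)| <= e / 2).
  have /(_ _ _ e2 eta3)[k _ /(_ _ (leqnn k)) ?] : opP P (fun k w =>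
      \sum_(i < 2 ^ n) y (tau n i) w * (block n k i w - ito_err n i w)).
    apply: opP_sum => i; apply: opPM; last exact: block_cvg.
    by apply: adapted_opP_OP => //; apply: tau_in; exact: ltnW.
  by exists k.
have mk : likely P (eta / 3)
    (fun w => (trunc_sum theta n k 0 (2 ^ (n + k)) w) ^+ 2 <= (e / 2) ^+ 2).
  have iso := @trunc_isometry theta n k 0 (2 ^ (n + k)) (ltW theta0) (leqnn _).
  have mV : measurable_fun setT (fun w => (trunc_sum theta n k 0 (2 ^ (n + k)) w) ^+ 2).
    by apply: measurable_funX; exact: measurable_trunc_sum.
  have := likely_markov mV (fun w => sqr_ge0 _) e22 iso.
  by apply: likelyS => //; rewrite dyad0 dyad_last.
have -> : eta = eta / 3 + (eta / 3 + eta / 3) by field.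
apply: (likelyS (lexx _) _ (likelyI small (likelyI hk mk))) => w [sm [hkw mkw]].
have {}sm j : (j <= 2 ^ (n + k))%N -> `|G n k j w| <= theta by exact: sm.
have TE : trunc_sum theta n k 0 (2 ^ (n + k)) w =
    \sum_(i < 2 ^ n) y (tau n i) w * block n k i w.
  rewrite /trunc_sum sum_refine big_mkord; apply: eq_bigr => i _.
  by rewrite (block_truncE (ltn_ord i) sm).
have -> : \sum_(0 <= i < 2 ^ n) y (tau n i) w * ito_err n i w =
    trunc_sum theta n k 0 (2 ^ (n + k)) w -
    \sum_(i < 2 ^ n) y (tau n i) w * (block n k i w - ito_err n i w).
  rewrite TE big_mkord -sumrB; apply: eq_bigr => i _; ring.
rewrite (splitr e) (le_trans (ler_normB _ _))// lerD//.
by rewrite -(ler_pXn2r (ltn0Sn 1)) ?nnegrE ?(ltW e2)// real_normK ?num_real.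
Unshelve. all: end_near. Qed.

(** Here the second moment bound is used on each block separately; the lengths of the coarse
    intervals add up to [t - a], which gives the same total. *)
Lemma ito_err_sqr :
  opP P (fun n w => \sum_(0 <= i < 2 ^ n) (y (tau n i) w * ito_err n i w) ^+ 2).
Proof.
move=> e eta e0 eta0.
have eta3 : 0 < eta / 3 by rewrite divr_gt0.
have e4 : 0 < e / 4 by rewrite divr_gt0.
have [theta theta0 thetaE] := threshold e4 eta3.
have [del del0 small] := likely_small theta0 eta3.
have nstep := near_dyad_step at_ del0.
near=> n.
have hn : (t - a) / 2 ^+ n <= del by near: n.
have [k hk] : exists k, likely P (eta / 3) (fun w =>
    `|\sum_(i < 2 ^ n) (y (tau n i) w * (block n k i w - ito_err n i w)) ^+ 2| <= e / 4).
  have /(_ _ _ e4 eta3)[k _ /(_ _ (leqnn k)) ?] : opP P (fun k w =>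
      \sum_(i < 2 ^ n) (y (tau n i) w * (block n k i w - ito_err n i w)) ^+ 2).
    apply: opP_sum => i.
    have oi : opP P (fun k w => y (tau n i) w * (block n k i w - ito_err n i w)).
      apply: opPM; last exact: block_cvg.
      by apply: adapted_opP_OP => //; apply: tau_in; exact: ltnW.
    by have := opPM (OP_opP oi) oi.
  by exists k.
pose V w := \sum_(0 <= i < 2 ^ n)
  (trunc_sum theta n k (i * 2 ^ k) (i.+1 * 2 ^ k) w) ^+ 2.
have mT (i : nat) : (i < 2 ^ n)%N ->
    measurable_fun setT (trunc_sum theta n k (i * 2 ^ k) (i.+1 * 2 ^ k)).
  by move=> ni; apply: measurable_trunc_sum; rewrite expnD leq_mul2r ni orbT.
have mV : measurable_fun setT V.
  apply: measurable_sum_nat => i /andP[_ ni]; apply: measurable_funX; exact: mT.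
have V0 w : 0 <= V w by apply: sumr_ge0 => i _; exact: sqr_ge0.
have VE : (\int[P]_w (V w)%:E <= (C * theta ^+ 2 * (t - a))%:E)%E.
  have -> : (\int[P]_w (V w)%:E = \int[P]_w (\sum_(i < 2 ^ n)
      ((trunc_sum theta n k (i * 2 ^ k) (i.+1 * 2 ^ k) w) ^+ 2)%:E))%E.
    by apply: eq_integral => w _; rewrite /V big_mkord sumEFin.
  rewrite ge0_integral_sum//; first last.
  - by move=> i w _; rewrite lee_fin sqr_ge0.
  - by move=> i; apply/measurable_EFinP; apply: measurable_funX; exact: mT.
  apply: (@le_trans _ _ (\sum_(i < 2 ^ n)
      (C * theta ^+ 2 * (tau n i.+1 - tau n i))%:E)%E).
    apply: lee_sum => i _; rewrite -(dyad_refine a t n k i) -(dyad_refine a t n k i.+1).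
    apply: trunc_isometry; first exact: ltW.
    by rewrite leq_mul2r leqnSn orbT expnD leq_mul2r ltn_ord orbT.
  rewrite sumEFin lee_fin -mulr_sumr -(big_mkord xpredT (fun i => tau n i.+1 - tau n i)).
  by rewrite telescope_sumr// dyad0 dyad_last.
have mk : likely P (eta / 3) (fun w => V w <= e / 4).
  by apply: likelyS (likely_markov mV V0 e4 VE).
have -> : eta = eta / 3 + (eta / 3 + eta / 3) by field.
apply: (likelyS (lexx _) _ (likelyI small (likelyI hk mk))) => w [sm [hkw mkw]].
have {}sm j : (j <= 2 ^ (n + k))%N -> `|G n k j w| <= theta by exact: sm.
rewrite ger0_norm; last by apply: sumr_ge0 => i _; exact: sqr_ge0.
rewrite ger0_norm in hkw; last by apply: sumr_ge0 => i _; exact: sqr_ge0.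
(* With [u] the block and [v] the error, [v ^+ 2 <= 2 * u ^+ 2 + 2 * (u - v) ^+ 2]; two
   contributions of at most [e / 4], doubled, explain the choice of [e4]. *)
apply: (@le_trans _ _ (2 * V w + 2 *
  \sum_(i < 2 ^ n) (y (tau n i) w * (block n k i w - ito_err n i w)) ^+ 2)); last first.
  move: mkw hkw; move: (V w) (\sum_(i < _) _) => u v; lra.
rewrite /V !big_mkord !mulr_sumr -big_split/=; apply: ler_sum => i _.
rewrite -(block_truncE (ltn_ord i) sm).
rewrite (mulrBr (y (tau n i) w) (block n k i w)); set u := y _ w * block n k i w.
set v := y _ w * ito_err n i w.
rewrite -subr_ge0 (_ : _ - _ = (2 * u - v) ^+ 2) ?sqr_ge0//; ring.
Unshelve. all: end_near. Qed.

End ito_error.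

(** * Tightness and weighted covariation *)

Section square_sums.
Context (R : realType).
Implicit Types (u v : nat -> R).

Lemma sum_cauchy_schwarz N u v : (\sum_(0 <= i < N) u i * v i) ^+ 2 <=
  (\sum_(0 <= i < N) u i ^+ 2) * (\sum_(0 <= i < N) v i ^+ 2).
Proof.
set A := \sum_(0 <= i < N) u i ^+ 2; set B := \sum_(0 <= i < N) v i ^+ 2.
set S := \sum_(0 <= i < N) u i * v i.
have B0 : 0 <= B by apply: sumr_ge0 => i _; exact: sqr_ge0.
(* The factor [B] avoids a division: the product is the sum of the squares of [B * u i - S * v i].
   When [B] is 0 every [v i] vanishes, and this case is treated apart. *)
have H : 0 <= B * (A * B - S ^+ 2).
  have -> : B * (A * B - S ^+ 2) = \sum_(0 <= i < N) (B * u i - S * v i) ^+ 2.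
    under eq_bigr => i _.
      have -> : (B * u i - S * v i) ^+ 2 =
        B ^+ 2 * u i ^+ 2 - 2 * B * S * (u i * v i) + S ^+ 2 * v i ^+ 2 by ring.
      over.
    by rewrite big_split/= sumrB -!mulr_sumr -/A -/B -/S; ring.
  by apply: sumr_ge0 => i _; exact: sqr_ge0.
have [B_eq0|Bn0] := eqVneq B 0; last first.
  have Bgt0 : 0 < B by rewrite lt0r Bn0.
  by move: H; rewrite pmulr_rge0// subr_ge0.
suff -> : S = 0 by rewrite B_eq0 mulr0 expr0n.
rewrite /S big_nat big1// => i iN.
have : v i ^+ 2 <= 0.
  rewrite -B_eq0 /B (bigD1_seq i) ?mem_index_iota ?iota_uniq//=.
  by rewrite lerDl; apply: sumr_ge0 => j _; exact: sqr_ge0.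
by rewrite le_eqVlt ltNge sqr_ge0 orbF sqrf_eq0 => /eqP ->; rewrite mulr0.
Qed.

Lemma sum_sqr_le N u : \sum_(0 <= i < N) u i ^+ 2 <= (\sum_(0 <= i < N) `|u i|) ^+ 2.
Proof.
rewrite [leRHS]expr2 mulr_suml [leLHS]big_nat [leRHS]big_nat; apply: ler_sum => i iN.
rewrite -real_normK ?num_real// expr2 ler_wpM2l//.
rewrite (bigD1_seq i) ?mem_index_iota ?iota_uniq//=.
by rewrite lerDl; apply: sumr_ge0 => j _.
Qed.

End square_sums.

Section OP_sums.
Context (dO : measure_display) (Omega : measurableType dO) (R : realType).
Variable P : probability Omega R.
Implicit Types (U V : nat -> nat -> Omega -> R).

(** Applied to the increments of a process, [OPsq] is tightness of the discrete quadratic variations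
    along the dyadic levels; [opPsq] says that they vanish in the limit. *)
Definition OPsq U := OP P (fun n w => \sum_(0 <= i < 2 ^ n) U n i w ^+ 2).
Definition opPsq U := opP P (fun n w => \sum_(0 <= i < 2 ^ n) U n i w ^+ 2).

Lemma sum_sqr_ge0 U n w : 0 <= \sum_(0 <= i < 2 ^ n) U n i w ^+ 2.
Proof. by apply: sumr_ge0 => i _; exact: sqr_ge0. Qed.

(** [L] may depend on [eta]: bounds on paths and local Lipschitz constants are deterministic only
    off an event of small probability. *)
Lemma OPsq_le U V :
  (forall eta, 0 < eta -> exists L, \forall n \near \oo, likely P eta (fun w =>
    forall i, (i < 2 ^ n)%N -> `|U n i w| <= L * `|V n i w|)) ->
  OPsq V -> OPsq U.
Proof.
move=> UV oV eta eta0; have eta2 : 0 < eta / 2 by rewrite divr_gt0.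
have [L hL] := UV _ eta2; have [K K0 hK] := oV _ eta2.
exists (L ^+ 2 * K + 1); first by rewrite ltr_wpDl// mulr_ge0 ?sqr_ge0// ltW.
near=> n; have -> : eta = eta / 2 + eta / 2 by rewrite -splitr.
have h1 : likely P (eta / 2) (fun w => forall i, (i < 2 ^ n)%N ->
  `|U n i w| <= L * `|V n i w|) by near: n.
have h2 : likely P (eta / 2) (fun w =>
  `|\sum_(0 <= i < 2 ^ n) V n i w ^+ 2| <= K) by near: n.
apply: (likelyS (lexx _) _ (likelyI h1 h2)) => w [uv].
rewrite !ger0_norm ?sum_sqr_ge0// => vK.
apply: (@le_trans _ _ (L ^+ 2 * K)); last by rewrite lerDl.
apply: (@le_trans _ _ (L ^+ 2 * \sum_(0 <= i < 2 ^ n) V n i w ^+ 2)); last first.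
  by rewrite ler_wpM2l ?sqr_ge0.
rewrite mulr_sumr !big_nat; apply: ler_sum => i /andP[_ ni].
have {}uv := uv i ni.
rewrite -(real_normK (num_real (U n i w))) -(real_normK (num_real (V n i w))) -exprMn.
by rewrite ler_pXn2r// nnegrE// (le_trans _ uv).
Unshelve. all: end_near. Qed.

Lemma OPsqD U V : OPsq U -> OPsq V -> OPsq (fun n i w => U n i w + V n i w).
Proof.
move=> oU oV; have := OPM (OP_cst P 2) (OPD oU oV); apply: OP_le => eta eta0.
apply: ae_near_likely => //; apply: aeW => w n.
rewrite (ger0_norm (sum_sqr_ge0 (fun n i w => U n i w + V n i w) n w)) ger0_norm; last first.
  by rewrite mulr_ge0// addr_ge0// sum_sqr_ge0.
rewrite -big_split/= mulr_sumr; apply: ler_sum => i _.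
rewrite -subr_ge0 (_ : _ - _ = (U n i w - V n i w) ^+ 2) ?sqr_ge0//; ring.
Qed.

Lemma OPsqZ (c : R) U : OPsq U -> OPsq (fun n i w => c * U n i w).
Proof.
apply: OPsq_le => eta eta0; exists `|c|; near=> n; apply: likely_ae; first exact: ltW.
by apply: aeW => w i _; rewrite normrM.
Unshelve. all: end_near. Qed.

Lemma OPsq_sum (I : finType) (U : I -> nat -> nat -> Omega -> R) :
  (forall k, OPsq (U k)) -> OPsq (fun n i w => \sum_k U k n i w).
Proof.
move=> oU; rewrite /index_enum; elim: (Finite.enum _) => [|k s IH].
  apply: OP_le (OP_cst P 0) => eta eta0; apply: ae_near_likely => //.
  apply: aeW => w n; rewrite big1 ?normr0// => i _; by rewrite big_nil expr0n.
apply: OP_le (OPsqD (oU k) IH) => eta eta0; apply: ae_near_likely => //.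
apply: aeW => w n; rewrite le_eqVlt; apply/orP; left; apply/eqP.
by congr (`|_|); apply: eq_bigr => i _; rewrite big_cons.
Qed.

Lemma OPsq_ae U V : {ae P, forall w, forall n i, (i < 2 ^ n)%N -> U n i w = V n i w} ->
  OPsq V -> OPsq U.
Proof.
move=> UV; apply: OPsq_le => eta eta0; exists 1; near=> n.
apply: likely_ae; first exact: ltW.
by apply: filterS UV => w h i ni; rewrite h// mul1r.
Unshelve. all: end_near. Qed.

Lemma opP_sumM U V : OPsq U -> opPsq V ->
  opP P (fun n w => \sum_(0 <= i < 2 ^ n) U n i w * V n i w).
Proof.
move=> oU oV; apply: opP_sqr; apply: opP_le (opPM oU oV) => eta eta0.
apply: ae_near_likely => //; apply: aeW => w n.
by rewrite ger0_norm ?sqr_ge0// ger0_norm ?sum_cauchy_schwarz// mulr_ge0// sum_sqr_ge0.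
Qed.

Lemma OP_sum_normM U V : OPsq U -> OPsq V ->
  OP P (fun n w => \sum_(0 <= i < 2 ^ n) `|U n i w * V n i w|).
Proof.
move=> oU oV; apply: OP_le (OPD oU oV) => eta eta0; apply: ae_near_likely => //.
apply: aeW => w n; rewrite [leLHS]ger0_norm ?sumr_ge0//.
rewrite [leRHS]ger0_norm ?addr_ge0 ?sum_sqr_ge0//.
by rewrite -big_split/=; apply: ler_sum => i _; exact: ler_normM_sqrD.
Qed.

(** This brings the finite variation part of the solution, the covariations, into the estimates of
    square sums. *)
Lemma OPsq_norm U : OP P (fun n w => \sum_(0 <= i < 2 ^ n) `|U n i w|) -> OPsq U.
Proof.
move=> oU; apply: OP_le (OPM oU oU) => eta eta0; apply: ae_near_likely => //.
apply: aeW => w n; rewrite -expr2 [leLHS]ger0_norm ?sum_sqr_ge0//.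
by rewrite [leRHS]ger0_norm ?sqr_ge0// sum_sqr_le.
Qed.

Lemma opP_sum_small U V :
  (forall e eta, 0 < e -> 0 < eta -> \forall n \near \oo, likely P eta (fun w =>
    forall i, (i < 2 ^ n)%N -> `|U n i w| <= e)) ->
  OP P (fun n w => \sum_(0 <= i < 2 ^ n) `|V n i w|) ->
  opP P (fun n w => \sum_(0 <= i < 2 ^ n) U n i w * V n i w).
Proof.
move=> sU oV e eta e0 eta0; have eta2 : 0 < eta / 2 by rewrite divr_gt0.
have [K K0 hK] := oV _ eta2.
have eK : 0 < e / K by rewrite divr_gt0.
have hU := sU _ _ eK eta2.
near=> n; have -> : eta = eta / 2 + eta / 2 by rewrite -splitr.
have h1 : likely P (eta / 2) (fun w => forall i, (i < 2 ^ n)%N ->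
  `|U n i w| <= e / K) by near: n.
have h2 : likely P (eta / 2) (fun w =>
  `|\sum_(0 <= i < 2 ^ n) `|V n i w| | <= K) by near: n.
apply: (likelyS (lexx _) _ (likelyI h1 h2)) => w [uv].
rewrite ger0_norm ?sumr_ge0// => vK.
rewrite -[leRHS](divfK (lt0r_neq0 K0)).
apply: (@le_trans _ _ (e / K * \sum_(0 <= i < 2 ^ n) `|V n i w|)); last first.
  by rewrite ler_wpM2l// ltW.
rewrite (le_trans (ler_norm_sum _ _ _))// mulr_sumr !big_nat.
by apply: ler_sum => i /andP[_ ni]; rewrite normrM ler_wpM2r// uv.
Unshelve. all: end_near. Qed.

End OP_sums.

Section covariation.
Context (dO : measure_display) (Omega : measurableType dO) (R : realType).
Variable P : probability Omega R.
Variables (a b t : R) (F : R -> set (set Omega)).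
Hypotheses (hF : filtration a b F) (at_ : a < t) (tb : t <= b).
Local Notation tau := (dyad a t).
Local Notation incr := (dyad_incr a t).

Let ab : a <= b. Proof. exact: le_trans (ltW at_) tb. Qed.
Let tau_in n j : (j <= 2 ^ n)%N -> tau n j \in `[a, b].
Proof. exact: dyad_in_ab. Qed.

Lemma incr_small Y : adapted a b F Y -> continuous_process P a b Y ->
  forall e eta, 0 < e -> 0 < eta -> \forall n \near \oo, likely P eta (fun w =>
    forall i, (i < 2 ^ n)%N -> `|incr Y n i w| <= e).
Proof.
move=> aY cY e eta e0 eta0.
have [del del0 hdel] :=
  continuous_process_modulus ab (adapted_measurable hF aY) cY e0 eta0.
apply: filterS (near_dyad_step at_ del0) => n hn.
apply: likelyS hdel => // w h i ni; apply: h.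
- exact: tau_in.
- exact: tau_in (ltnW ni).
- by rewrite dyad_step ger0_norm// ltW// dyad_step_gt0.
Qed.

Lemma OPsq_driver Z C : adapted a b F Z -> ito_driver P a b F Z C ->
  OPsq P (incr Z).
Proof.
move=> aZ iZ eta eta0.
pose v := C * (t - a).
(* Chosen so that the Markov bound [v / K] is at most [eta]. The absolute value is there because [C]
   carries no sign here, and the 1 keeps [K] positive. *)
pose K := `|v| / eta + 1.
have K0 : 0 < K by rewrite ltr_wpDl// divr_ge0// ltW.
exists K => //; near=> n.
pose V w := \sum_(0 <= i < 2 ^ n) incr Z n i w ^+ 2.
have mZ := adapted_measurable hF aZ.
have mI i : (i < 2 ^ n)%N -> measurable_fun setT (incr Z n i).
  by move=> ni; apply: measurable_funB; apply: mZ; apply: tau_in => //; exact: ltnW.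
have mV : measurable_fun setT V.
  by apply: measurable_sum_nat => i /andP[_ ni]; apply: measurable_funX; exact: mI.
have V0 w : 0 <= V w by exact: sum_sqr_ge0.
have VE : (\int[P]_w (V w)%:E <= v%:E)%E.
  have -> : (\int[P]_w (V w)%:E =
      \int[P]_w (\sum_(i < 2 ^ n) (incr Z n i w ^+ 2)%:E))%E.
    by apply: eq_integral => w _; rewrite /V big_mkord sumEFin.
  rewrite ge0_integral_sum//; first last.
  - by move=> i w _; rewrite lee_fin sqr_ge0.
  - by move=> i; apply/measurable_EFinP; apply: measurable_funX; exact: mI.
  apply: (@le_trans _ _ (\sum_(i < 2 ^ n) (C * (tau n i.+1 - tau n i))%:E)%E).
    apply: lee_sum => i _.
    (* Integrand 1 on a single step: the second moment of one increment is at most [C] times the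
       step. *)
    have := iZ (tau n) (fun _ _ => 1) 1 i i.+1 (leqnSn i).
    rewrite expr1n mulr1 => H.
    apply: (le_trans _ (H _ _ _ _)).
    - rewrite le_eqVlt; apply/orP; left; apply/eqP; apply: eq_integral => w _.
      by rewrite big_nat1 mul1r.
    - by move=> j /andP[_ ji]; apply: tau_in; exact: leq_trans ji (ltn_ord i).
    - by move=> j _; exact: dyad_lt.
    - move=> j /andP[_ ji].
      have jab : tau n j \in `[a, b].
        by apply: tau_in; exact: leq_trans (ltnW ji) (ltn_ord i).
      have sF : sigma_algebra setT (F (tau n j)) by case: hF => h _ _; exact: h.
      by apply/(sub_measurableP sF); exact: measurable_cst.
    - by move=> j _ w; rewrite normr1.
  rewrite sumEFin lee_fin -mulr_sumr -(big_mkord xpredT (fun i => tau n i.+1 - tau n i)).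
  by rewrite telescope_sumr// dyad0 dyad_last.
apply: likelyS (likely_markov mV V0 K0 VE) => //; last by move=> w Vw; rewrite ger0_norm ?sum_sqr_ge0.
rewrite ler_pdivrMr// /K mulrDr mulr1 mulrC divfK ?gt_eqF//.
by rewrite (le_trans (ler_norm _))// lerDl ltW.
Unshelve. all: end_near. Qed.

Variables (c Z J Q : R -> Omega -> R) (C : R).
Hypotheses (C0 : 0 < C) (iZ : ito_driver P a b F Z C) (aZ : adapted a b F Z).
Hypotheses (ac : adapted a b F c) (cc : continuous_process P a b c).
Hypotheses (hJ : ito_integral P F a b c Z J) (hQ : covariation P F a b c Z Q).

Lemma ito_err_opPsq : opPsq P (ito_err a t c Z J).
Proof.
have a1 : adapted a b F (fun _ _ => 1).
  move=> u uab; have sF : sigma_algebra setT (F u) by case: hF => h _ _; exact: h.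
  by apply/(sub_measurableP sF); exact: measurable_cst.
have c1 : continuous_process P a b (fun _ _ => 1 : R).
  by apply: aeW => w; apply: continuous_subspaceT => x; exact: cst_continuous.
have := ito_err_sqr hF at_ tb C0 iZ aZ ac cc hJ a1 c1.
apply: opP_le => eta eta0; apply: ae_near_likely => //; apply: aeW => w n.
by under [in leRHS]eq_bigr do rewrite mul1r.
Qed.

(** The increment of [J] is [ito_err] plus [c] times the increment of [Z]: square sums of the first
    vanish, those of the second are tight because [c] is bounded off a small event. *)
Lemma OPsq_ito : OPsq P (incr J).
Proof.
have H : OPsq P (fun n i w => c (tau n i) w * incr Z n i w).
  apply: OPsq_le (OPsq_driver aZ iZ) => eta eta0.
  have [K K0 hK] := continuous_process_bounded ab (adapted_measurable hF ac) cc eta0.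
  exists K; near=> n; apply: likelyS hK => // w cK i ni.
  by rewrite normrM ler_wpM2r// cK// tau_in// ltnW.
apply: OPsq_ae (OPsqD (OP_opP ito_err_opPsq) H).
by apply: aeW => w n i _; rewrite /ito_err subrK.
Unshelve. all: end_near. Qed.

Lemma OP_covariation : OP P (fun n w => \sum_(0 <= i < 2 ^ n) `|incr Q n i w|).
Proof.
have [aQ _ bvQ _] := hQ.
exact: bounded_variation_dyadic at_ tb _ (adapted_measurable hF aQ) bvQ.
Qed.

Variable y : R -> Omega -> R.
Hypotheses (ay : adapted a b F y) (cy : continuous_process P a b y).

(* Since the total masses of [q n] are tight, [y] may be replaced by its values
   on a coarser dyadic grid. *)
Lemma weighted_sum_opP (q : nat -> nat -> Omega -> R) :
  OP P (fun n w => \sum_(0 <= j < 2 ^ n) `|q n j w|) ->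
  (forall n i, (i < 2 ^ n)%N ->
    opP P (fun k w => \sum_(i * 2 ^ k <= j < i.+1 * 2 ^ k) q (n + k)%N j w)) ->
  opP P (fun n w => \sum_(0 <= j < 2 ^ n) y (tau n j) w * q n j w).
Proof.
move=> tq lq e eta e0 eta0.
have eta3 : 0 < eta / 3 by rewrite divr_gt0.
have e2 : 0 < e / 2 by rewrite divr_gt0.
have [K K0 hK] := tq _ eta3.
have eK : 0 < e / 2 / K by rewrite divr_gt0.
have [del del0 hdel] :=
  continuous_process_modulus ab (adapted_measurable hF ay) cy eK eta3.
have [n0 _ /(_ _ (leqnn n0)) hn0] := near_dyad_step at_ del0.
have blk : opP P (fun k w => \sum_(i < 2 ^ n0) y (tau n0 i) w *
    \sum_(i * 2 ^ k <= j < i.+1 * 2 ^ k) q (n0 + k)%N j w).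
  apply: opP_sum => i; apply: opPM; last exact: lq.
  by apply: (adapted_opP_OP hF at_ tb) => //; apply: tau_in; exact: ltnW.
have [k0 _ hk0] := blk _ _ e2 eta3.
have [n1 _ hn1] := hK.
exists (n0 + k0 + n1)%N => // n /= nge.
(* The coarse level [n0] is now fixed, so convergence of its finitely many blocks as [k] grows
   becomes a statement about all large [n]. *)
have [k nE] : exists k, n = (n0 + k)%N.
  by exists (n - n0)%N; rewrite subnKC// (leq_trans _ nge)// -addnA leq_addr.
have k0k : (k0 <= k)%N.
  by move: nge; rewrite nE -addnA leq_add2l; apply: leq_trans; rewrite leq_addr.
have n1n : (n1 <= n)%N by apply: leq_trans nge; rewrite leq_addl.
have -> : eta = eta / 3 + (eta / 3 + eta / 3) by field.
apply: (likelyS (lexx _) _ (likelyI hdel (likelyI (hk0 k k0k) (hn1 n n1n)))).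
move=> w [hd [hb ht]].
rewrite ger0_norm ?sumr_ge0// in ht.
have -> : \sum_(0 <= j < 2 ^ n) y (tau n j) w * q n j w =
    \sum_(0 <= i < 2 ^ n0) \sum_(i * 2 ^ k <= j < i.+1 * 2 ^ k)
      (y (tau n j) w - y (tau n0 i) w) * q n j w +
    \sum_(i < 2 ^ n0) y (tau n0 i) w *
      \sum_(i * 2 ^ k <= j < i.+1 * 2 ^ k) q (n0 + k)%N j w.
  rewrite nE sum_refine !big_mkord -big_split/=; apply: eq_bigr => i _.
  by rewrite mulr_sumr -big_split/=; apply: eq_bigr => j _; ring.
rewrite (splitr e) (le_trans (ler_normD _ _))// lerD//.
rewrite -[leRHS](divfK (lt0r_neq0 K0)).
apply: (@le_trans _ _ (e / 2 / K * \sum_(0 <= j < 2 ^ n) `|q n j w|)); last first.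
  by rewrite ler_wpM2l// ltW.
rewrite nE sum_refine (le_trans (ler_norm_sum _ _ _))// mulr_sumr !big_nat.
apply: ler_sum => i /andP[_ in0].
rewrite (le_trans (ler_norm_sum _ _ _))// mulr_sumr !big_nat.
apply: ler_sum => j /andP[ij ji]; rewrite normrM ler_wpM2r//.
have jn : (j < 2 ^ (n0 + k))%N.
  by rewrite (leq_trans ji)// expnD leq_mul2r in0 orbT.
apply: hd; [exact: tau_in (ltnW _) | exact: tau_in (ltnW _) |].
apply: le_trans hn0; rewrite -(dyad_step a t n0 i) -!(dyad_refine a t n0 k).
rewrite ger0_norm ?subr_ge0 ?dyad_le// lerD2r dyad_le// ltnW//.
Qed.

End covariation.

(** * Quadratic invariants *)

Section quadratic_invariant.
Context (dO : measure_display) (Omega : measurableType dO) (R : realType).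
Variable P : probability Omega R.
Variables (a b t : R) (F : R -> set (set Omega)).
Hypotheses (hF : filtration a b F) (at_ : a < t) (tb : t <= b).
Local Notation tau := (dyad a t).
Local Notation incr := (dyad_incr a t).

Let ab : a <= b. Proof. exact: le_trans (ltW at_) tb. Qed.
Let tau_in n j : (j <= 2 ^ n)%N -> tau n j \in `[a, b].
Proof. exact: dyad_in_ab. Qed.

Section term.
Variables (y c Z J Q : R -> Omega -> R) (C : R).
Hypotheses (C0 : 0 < C) (iZ : ito_driver P a b F Z C) (aZ : adapted a b F Z).
Hypothesis cZ : continuous_process P a b Z.
Hypotheses (ac : adapted a b F c) (cc : continuous_process P a b c).
Hypotheses (hJ : ito_integral P F a b c Z J) (hQ : covariation P F a b c Z Q).
Hypotheses (ay : adapted a b F y) (cy : continuous_process P a b y).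
Hypotheses (qy : OPsq P (incr y)) (qc : OPsq P (incr c)).

(** Both requirements of [weighted_sum_opP] hold: the masses are tight by the finite variation of
    [Q] and the tight square sums of [c] and [Z], and the block sums vanish by the very definition
    of the covariation. *)
Lemma covariation_weighted : opP P (fun n w => \sum_(0 <= i < 2 ^ n)
  y (tau n i) w * (incr Q n i w - incr c n i w * incr Z n i w)).
Proof.
have [aQ _ _ lQ] := hQ.
apply: (weighted_sum_opP hF at_ tb ay cy).
  apply: OP_le (OPD (OP_covariation hF at_ tb hQ)
    (OP_sum_normM qc (OPsq_driver hF at_ tb aZ iZ))) => eta eta0.
  apply: ae_near_likely => //; apply: aeW => w n.
  rewrite [leLHS]ger0_norm ?sumr_ge0// [leRHS]ger0_norm ?addr_ge0 ?sumr_ge0//.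
  by rewrite -big_split/=; apply: ler_sum => i _; exact: ler_normB.
move=> n i ni.
have mc := adapted_measurable hF ac; have mZ := adapted_measurable hF aZ.
have mQ := adapted_measurable hF aQ.
have mh u v : u \in `[a, b] -> v \in `[a, b] ->
    measurable_fun setT (fun w => (c v w - c u w) * (Z v w - Z u w)).
  by move=> uab vab; apply: measurable_funM; apply: measurable_funB;
    [exact: mc|exact: mc|exact: mZ|exact: mZ].
have lim := limit_dyadic at_ tb lQ mh mQ.
apply: opP_le (opPD (lim n i.+1 ni) (opPZ (- 1) (lim n i (ltnW ni)))) => eta eta0.
apply: ae_near_likely => //; apply: aeW => w k.
rewrite (@big_cat_nat _ _ _ (i * 2 ^ k) 0 (i.+1 * 2 ^ k))//=; last first.
  by rewrite leq_mul2r leqnSn orbT.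
have -> : \sum_(i * 2 ^ k <= j < i.+1 * 2 ^ k)
    (incr Q (n + k) j w - incr c (n + k) j w * incr Z (n + k) j w) =
  Q (tau n i.+1) w - Q (tau n i) w -
  \sum_(i * 2 ^ k <= j < i.+1 * 2 ^ k) incr c (n + k) j w * incr Z (n + k) j w.
  rewrite sumrB /incr telescope_sumr ?leq_mul2r ?leqnSn ?orbT//.
  by rewrite !dyad_refine.
rewrite le_eqVlt; apply/orP; left; apply/eqP; rewrite -normrN; congr (`|_|).
by rewrite /incr; ring.
Qed.

(* What remains of (2 y + dy) (dJ + dQ / 2), with dJ = err + c dZ, up to
   dZ (y_u c_u + y_v c_v), which cancels in the sum over the coordinates. *)
Definition stratonovich_term n i w :=
  2 * (y (tau n i) w * ito_err a t c Z J n i w) +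
  incr y n i w * ito_err a t c Z J n i w +
  y (tau n i) w * (incr Q n i w - incr c n i w * incr Z n i w) +
  - 1 * (incr Z n i w * (incr y n i w * incr c n i w)) +
  2^-1 * (incr y n i w * incr Q n i w).

(** Term by term: the weighted error; tight increments of [y] against errors with vanishing square
    sums (Cauchy-Schwarz); the weighted covariation; uniformly small increments of [Z] against the
    tight sums of products of increments of [y] and [c]; uniformly small increments of [y] against
    the tight variation of [Q]. *)
Lemma stratonovich_term_opP :
  opP P (fun n w => \sum_(0 <= i < 2 ^ n) stratonovich_term n i w).
Proof.
have h1 := opPZ 2 (ito_err_weighted hF at_ tb C0 iZ aZ ac cc hJ ay cy).
have h2 := opP_sumM qy (ito_err_opPsq hF at_ tb C0 iZ aZ ac cc hJ).
have h4 := opPZ (- 1) (opP_sum_small (incr_small hF at_ tb aZ cZ) (OP_sum_normM qy qc)).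
have h5 := opPZ 2^-1 (opP_sum_small (incr_small hF at_ tb ay cy)
  (OP_covariation hF at_ tb hQ)).
apply: opP_le (opPD (opPD (opPD (opPD h1 h2) covariation_weighted) h4) h5) => eta eta0.
apply: ae_near_likely => //; apply: aeW => w n.
rewrite le_eqVlt; apply/orP; left; apply/eqP; congr (`|_|).
by rewrite !mulr_sumr -!big_split.
Qed.

End term.

Variables (d N : nat) (x y : 'I_d -> R -> Omega -> R).
Variables (D : 'M[R]_d) (c S : 'I_N -> 'I_d -> R -> Omega -> R).
Variables (Z : 'I_N -> R -> Omega -> R) (C : 'I_N -> R).
Hypotheses (C0 : forall m, 0 < C m) (iZ : forall m, ito_driver P a b F (Z m) (C m)).
Hypotheses (aZ : forall m, adapted a b F (Z m)) (cZ : forall m, continuous_process P a b (Z m)).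
Hypotheses (ax : forall l, adapted a b F (x l)) (cx : forall l, continuous_process P a b (x l)).
Hypotheses (ay : forall l, adapted a b F (y l)) (cy : forall l, continuous_process P a b (y l)).
Hypotheses (ac : forall m l, adapted a b F (c m l))
  (cc : forall m l, continuous_process P a b (c m l)).
Hypothesis sym : D^T = D.
Hypothesis yE : forall l u w, y l u w = \sum_l' D l l' * x l' u w.
Hypothesis cLip : forall m l K, exists L, forall u v w,
  (forall l', `|x l' u w| <= K) -> (forall l', `|x l' v w| <= K) ->
  `|c m l u w - c m l v w| <= L * \sum_l' `|x l' u w - x l' v w|.
Hypothesis orth : forall m u w, \sum_l y l u w * c m l u w = 0.
Hypothesis hS : forall m l, stratonovich_integral P F a b (c m l) (Z m) (S m l).
Hypothesis xE : {ae P, forall w u, u \in `[a, b] ->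
  forall l, x l u w = x l a w + \sum_m S m l u w}.

Lemma quadratic_invariant_at :
  {ae P, forall w, \sum_l y l t w * x l t w = \sum_l y l a w * x l a w}.
Proof.
have /choice[JQ hJQ] : forall ml : 'I_N * 'I_d, exists JQ : (R -> Omega -> R) * (R -> Omega -> R),
    [/\ ito_integral P F a b (c ml.1 ml.2) (Z ml.1) JQ.1,
        covariation P F a b (c ml.1 ml.2) (Z ml.1) JQ.2 &
        {ae P, forall w, forall t, t \in `[a, b] ->
          S ml.1 ml.2 t w = JQ.1 t w + 2^-1 * JQ.2 t w}].
  by move=> [m l]; have [J [Q H]] := hS m l; exists (J, Q).
pose J m l := (JQ (m, l)).1; pose Q m l := (JQ (m, l)).2.
have hJ m l : ito_integral P F a b (c m l) (Z m) (J m l) by case: (hJQ (m, l)).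
have hQ m l : covariation P F a b (c m l) (Z m) (Q m l) by case: (hJQ (m, l)).
have SE : {ae P, forall w, forall ml : 'I_N * 'I_d, forall t, t \in `[a, b] ->
    S ml.1 ml.2 t w = J ml.1 ml.2 t w + 2^-1 * Q ml.1 ml.2 t w}.
  apply: ae_likely => eta eta0.
  have h ml : likely P 0 (fun w => forall t, t \in `[a, b] ->
      S ml.1 ml.2 t w = J ml.1 ml.2 t w + 2^-1 * Q ml.1 ml.2 t w).
    by apply: likely_ae => //; case: ml => m l; case: (hJQ (m, l)).
  by apply: likelyS (likely_forall h) => //; rewrite mul0rn ltW.
have dxE : {ae P, forall w, forall l n i, (i < 2 ^ n)%N -> incr (x l) n i w =
    \sum_m (incr (J m l) n i w + 2^-1 * incr (Q m l) n i w)}.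
  apply: filterS2 xE SE => w xw Sw l n i ni.
  have i1 := tau_in ni; have i0 := tau_in (ltnW ni).
  rewrite /incr (xw _ i1) (xw _ i0) opprD addrACA subrr add0r -sumrB.
  apply: eq_bigr => m _; rewrite (Sw (m, l) _ i1) (Sw (m, l) _ i0) /=; ring.
(* The tight square sums of the solution come from the equation itself, through its Ito integrals
   and covariations; [y] inherits them linearly and [c] by the local Lipschitz bound. *)
have qx l : OPsq P (incr (x l)).
  apply: (OPsq_ae (V := fun n i w =>
      \sum_m (incr (J m l) n i w + 2^-1 * incr (Q m l) n i w))).
    by apply: filterS dxE => w; exact.
  apply: OPsq_sum => m; apply: OPsqD.
    exact: (OPsq_ito hF at_ tb (C0 m) (iZ m) (aZ m) (ac m l) (cc m l) (hJ m l)).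
  apply: OPsqZ; apply: OPsq_norm; exact: (OP_covariation hF at_ tb (hQ m l)).
have qy l : OPsq P (incr (y l)).
  apply: (OPsq_ae (V := fun n i w => \sum_l' D l l' * incr (x l') n i w)).
    apply: aeW => w n i _; rewrite /incr !yE -sumrB.
    by apply: eq_bigr => l' _; rewrite mulrBr.
  by apply: OPsq_sum => l'; exact: OPsqZ.
have qc m l : OPsq P (incr (c m l)).
  apply: (@OPsq_le _ _ _ _ _ (fun n i w => \sum_l' `|incr (x l') n i w|)).
    (* One exceptional set of mass [e'] per coordinate costs at most [eta] in total; [d.+1] also
       covers dimension 0. *)
    move=> eta eta0; pose e' := eta / d.+1%:R.
    have e'0 : 0 < e' by rewrite divr_gt0.
    have [K hK] : exists K, forall l, likely P e' (fun w =>
        forall u, u \in `[a, b] -> `|x l u w| <= K).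
      have /choice[K hK] : forall l, exists K, likely P e' (fun w =>
          forall u, u \in `[a, b] -> `|x l u w| <= K).
        move=> l'; have [K _ hK] := continuous_process_bounded ab
          (adapted_measurable hF (ax l')) (cx l') e'0.
        by exists K.
      exists (\sum_l' `|K l'|) => l'; apply: likelyS (hK l') => // w h u uab.
      rewrite (le_trans (h u uab))// (bigD1 l')//= (le_trans (ler_norm _))//.
      by rewrite lerDl sumr_ge0.
    have [L hL] := cLip m l K; exists `|L|; near=> n.
    apply: likelyS (likely_forall hK).
      rewrite card_ord; apply: (@le_trans _ _ (e' *+ d.+1)).
        by rewrite mulrS lerDr ltW.
      by rewrite -(mulr_natr e' d.+1) divfK.
    move=> w xK i ni; have i1 := tau_in ni; have i0 := tau_in (ltnW ni).
    have := hL (tau n i.+1) (tau n i) w (fun l' => xK l' _ i1) (fun l' => xK l' _ i0).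
    move=> /le_trans; apply; rewrite (ger0_norm (sumr_ge0 _ _))//.
    by rewrite ler_wpM2r ?ler_norm// sumr_ge0.
  apply: OPsq_sum => l'; apply: OPsq_le (qx l') => eta eta0; exists 1; near=> n.
  apply: likely_ae; first exact: ltW.
  by apply: aeW => w i _; rewrite normr_id mul1r.
pose U w := \sum_l y l t w * x l t w - \sum_l y l a w * x l a w.
have oU : opP P (fun _ => U).
  have oT : opP P (fun n w => \sum_m \sum_l \sum_(0 <= i < 2 ^ n)
      stratonovich_term (y l) (c m l) (Z m) (J m l) (Q m l) n i w).
    apply: opP_sum => m; apply: opP_sum => l.
    exact: (stratonovich_term_opP (C0 m) (iZ m) (aZ m) (cZ m) (ac m l) (cc m l)
      (hJ m l) (hQ m l) (ay l) (cy l) (qy l) (qc m l)).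
  apply: opP_le oT => eta eta0; apply: ae_near_likely => //.
  apply: filterS dxE => w dxw n.
  rewrite le_eqVlt; apply/orP; left; apply/eqP; congr (`|_|).
  have step u v : \sum_l y l v w * x l v w - \sum_l y l u w * x l u w =
      \sum_l (2 * y l u w + (y l v w - y l u w)) * (x l v w - x l u w).
    (* Symmetry of [D] enters here: it removes the mixed terms, so that the increment of the
       quadratic form has no second order remainder. *)
    have cross : \sum_l y l u w * x l v w = \sum_l y l v w * x l u w.
      under eq_bigr do rewrite yE mulr_suml.
      under [RHS]eq_bigr do rewrite yE mulr_suml.
      rewrite exchange_big; apply: eq_bigr => l _; apply: eq_bigr => l' _.
      by rewrite -{1}sym mxE; ring.
    transitivity (\sum_l y l v w * x l v w - \sum_l y l u w * x l u w +
        (\sum_l y l u w * x l v w - \sum_l y l v w * x l u w)).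
      by rewrite cross subrr addr0.
    by rewrite -!sumrB -big_split/=; apply: eq_bigr => l _; ring.
  have -> : U w = \sum_(0 <= i < 2 ^ n) \sum_l
      (2 * y l (tau n i) w + incr (y l) n i w) * incr (x l) n i w.
    have := telescope_sumr (fun i => \sum_l y l (tau n i) w * x l (tau n i) w)
      (leq0n (2 ^ n)).
    rewrite /= dyad_last dyad0 /U => <-.
    by apply: eq_bigr => i _; rewrite step.
  have -> : \sum_m \sum_l \sum_(0 <= i < 2 ^ n)
      stratonovich_term (y l) (c m l) (Z m) (J m l) (Q m l) n i w =
    \sum_(0 <= i < 2 ^ n) \sum_m \sum_l
      stratonovich_term (y l) (c m l) (Z m) (J m l) (Q m l) n i w.
    by rewrite [RHS]exchange_big/=; apply: eq_bigr => m _; rewrite exchange_big.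
  rewrite [LHS]big_nat [RHS]big_nat; apply: eq_bigr => i /andP[_ ni].
  under eq_bigr do rewrite dxw// mulr_sumr.
  rewrite exchange_big/=; apply: eq_bigr => m _.
  apply/eqP; rewrite -subr_eq0 -sumrB; apply/eqP.
  (* The two sides differ by a trapezoidal sum: orthogonality of [y] and [c] is used at both ends of
     the interval, which is where the Stratonovich correction matters. *)
  transitivity (incr (Z m) n i w * (\sum_l y l (tau n i) w * c m l (tau n i) w +
      \sum_l y l (tau n i.+1) w * c m l (tau n i.+1) w)).
    rewrite -big_split/= mulr_sumr; apply: eq_bigr => l _.
    rewrite /stratonovich_term /ito_err /dyad_incr; by field.
  by rewrite !orth addr0 mulr0.
(* [U] does not depend on the level, so convergence to 0 in probability forces it to vanish almost
   surely. *)
have aeU k : {ae P, forall w, `|U w| <= k.+1%:R^-1}.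
  apply: ae_likely => eta eta0.
  have k0 : 0 < (k.+1%:R^-1 : R) by rewrite invr_gt0.
  by have [n _ /(_ n (leqnn n))] := oU _ _ k0 eta0.
apply: filterS (ae_foralln aeU) => w Uw.
apply/eqP; rewrite -subr_eq0 -/(U w) -normr_le0; apply/ler_addgt0Pr => e e0.
rewrite add0r; have [k _ /(_ k (leqnn k)) ke] := near_infty_natSinv_lt (PosNum e0).
exact: le_trans (Uw k) (ltW ke).
Unshelve. all: end_near. Qed.

End quadratic_invariant.

(** * Matrix exponential *)

Section exp_poly.
Context (R : realType).

(** The truncated series of [exp (z X)]. As evaluation at a matrix is a ring morphism, products of
    truncated matrix exponentials reduce to coefficients of scalar polynomials. *)
Definition exp_poly (z : R) n : {poly R} := \poly_(k < n) (z ^+ k / k`!%:R).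

Lemma coef_exp_polyM z n k : (k < n)%N ->
  (exp_poly z n * exp_poly 1 n)`_k = (1 + z) ^+ k / k`!%:R.
Proof.
move=> kn; rewrite coefM exprDn mulr_suml; apply: eq_bigr => i _.
have ik : (i <= k)%N by rewrite -ltnS.
rewrite !coef_poly (leq_ltn_trans ik kn) (leq_ltn_trans (leq_subr _ _) kn).
rewrite !expr1n !mul1r -mulr_natr.
have f0 (m : nat) : m`!%:R != 0 :> R by rewrite pnatr_eq0 -lt0n fact_gt0.
apply: (mulIf (f0 k)); rewrite mulrAC divfK//.
rewrite -(bin_fact ik) !natrM; field; rewrite !f0//.
Qed.

Lemma horner_exp_poly z n (x : R) :
  (exp_poly z n).[x] = \sum_(k < n) (z * x) ^+ k / k`!%:R.
Proof. by rewrite horner_poly; apply: eq_bigr => k _; rewrite exprMn mulrAC. Qed.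

Lemma horner_exp_poly_cvg z (x : R) : (exp_poly z n).[x] @[n --> \oo] --> expR (z * x).
Proof.
have -> : (fun n => (exp_poly z n).[x]) = series (exp_coeff (z * x)).
  apply/funext => n; rewrite horner_exp_poly /series/= big_mkord.
  by apply: eq_bigr => k _; rewrite exp_coeffE mulrC.
exact: is_cvg_series_exp_coeff.
Qed.

(* The coefficients below [n] of [exp_poly (-1) n * exp_poly 1 n] are those of
   [1]; the others are dominated by those of [exp_poly 1 n ^+ 2]. *)
Lemma exp_polyN_norm n (x : R) : 0 <= x -> (0 < n)%N ->
  \sum_(k < n + n) `|(exp_poly (-1) n * exp_poly 1 n - 1)`_k| * x ^+ k <=
  (exp_poly 1 n).[x] ^+ 2 - (exp_poly 2 n).[x].
Proof.
move=> x0 n0; rewrite lerBrDr.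
have sz : (size (exp_poly 1 n * exp_poly 1 n)%R <= n + n)%N.
  rewrite (leq_trans (size_polyMleq _ _))// (leq_trans (leq_pred _))//.
  by rewrite leq_add// size_poly.
have -> : (exp_poly 1 n).[x] ^+ 2 =
    \sum_(k < n + n) (exp_poly 1 n * exp_poly 1 n)`_k * x ^+ k.
  by rewrite expr2 -hornerM (horner_coef_wide _ sz).
have -> : (exp_poly 2 n).[x] = \sum_(k < n + n) (exp_poly 2 n)`_k * x ^+ k.
  by rewrite (@horner_coef_wide _ (n + n))// (leq_trans (size_poly _ _))// leq_addr.
rewrite -big_split/=; apply: ler_sum => k _; rewrite -mulrDl ler_wpM2r ?exprn_ge0//.
rewrite coefB coef1 [(exp_poly 2 n)`_k]coef_poly; case: ifPn => kn.
  rewrite !coef_exp_polyM// addrN expr0n.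
  have -> : (k == 0%N :> nat)%:R / k`!%:R - (k == 0%N :> nat)%:R = 0 :> R.
    by case: (val k) => [|m] /=; rewrite ?fact0 ?divr1 ?subrr// mul0r subrr.
  by rewrite normr0 add0r.
have k0 : (k == 0%N :> nat) = false.
  by apply/negbTE; apply: contra kn => /eqP ->.
rewrite k0 subr0 addr0 !coefM (le_trans (ler_norm_sum _ _ _))//.
apply: ler_sum => i _; rewrite normrM !coef_poly.
apply: ler_pM => //; last by case: ifP => _; rewrite ?normr0// expr1n mul1r ger0_norm.
by case: ifP => _; rewrite ?normr0// normrM normrX normrN normr1 !expr1n !mul1r ger0_norm.
Qed.

End exp_poly.

Section expmx.
Context (R : realType) (d : nat).
Implicit Types (A B : 'M[R]_d.+1).

(** It dominates every row sum, which is what the induction on the entries of powers requires. *)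
Definition mx_sumnorm B : R := \sum_i \sum_j `|B i j|.

Lemma mx_sumnorm_ge0 B : 0 <= mx_sumnorm B.
Proof. by apply: sumr_ge0 => i _; apply: sumr_ge0. Qed.

Lemma mxX_le_sumnorm B k i j : `|(B ^+ k) i j| <= mx_sumnorm B ^+ k.
Proof.
elim: k i j => [|k IH] i j.
  by rewrite !expr0 mxE; case: (i == j); rewrite ?normr1 ?normr0.
rewrite exprS mxE (le_trans (ler_norm_sum _ _ _))// exprS.
apply: (@le_trans _ _ (\sum_l `|B i l| * mx_sumnorm B ^+ k)).
  by apply: ler_sum => l _; rewrite normrM ler_wpM2l.
rewrite -mulr_suml ler_wpM2r ?exprn_ge0 ?mx_sumnorm_ge0//.
by rewrite /mx_sumnorm [leRHS](bigD1 i)//= lerDl sumr_ge0// => l _; apply: sumr_ge0.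
Qed.

Lemma horner_mx_poly B n (u : nat -> R) :
  horner_mx B (\poly_(k < n) u k) = \sum_(k < n) u k *: B ^+ k.
Proof.
rewrite poly_def linear_sum; apply: eq_bigr => k _.
by rewrite linearZ/= rmorphXn/= horner_mx_X.
Qed.

Lemma horner_mx_wide B n (p : {poly R}) : (size p <= n)%N ->
  horner_mx B p = \sum_(k < n) p`_k *: B ^+ k.
Proof.
move=> pn; rewrite -horner_mx_poly; congr (horner_mx B _).
apply/polyP => k; rewrite coef_poly; case: ltnP => // nk.
by rewrite nth_default// (leq_trans pn).
Qed.

Lemma horner_mx_entry_le B n (p : {poly R}) i j : (size p <= n)%N ->
  `|horner_mx B p i j| <= \sum_(k < n) `|p`_k| * mx_sumnorm B ^+ k.
Proof.
move=> pn; rewrite (horner_mx_wide _ pn) summxE (le_trans (ler_norm_sum _ _ _))//.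
by apply: ler_sum => k _; rewrite mxE normrM ler_wpM2l// mxX_le_sumnorm.
Qed.

Lemma cvg_mx_entries m n (u : nat -> 'M[R]_(m, n)) (L : 'M[R]_(m, n)) :
  (forall i j, u k i j @[k --> \oo] --> L i j) -> u k @[k --> \oo] --> L.
Proof.
move=> uL; apply/cvgrPdist_lt => e e0.
have : \forall k \near \oo, forall ij : 'I_m * 'I_n, `|L ij.1 ij.2 - u k ij.1 ij.2| < e.
  apply: filter_forall => -[i j] /=; have /cvgrPdist_lt := uL i j; exact.
apply: filterS => k h; rewrite /Num.norm/= mx_normrE; apply/bigmax_ltP; split => // ij _.
by rewrite !mxE.
Qed.

Lemma expmx_series B n :
  series (fun k : nat => k`!%:R^-1 *: B ^+ k) n = horner_mx B (exp_poly 1 n).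
Proof.
rewrite horner_mx_poly /series/= big_mkord; apply: eq_bigr => k _.
by rewrite expr1n mul1r.
Qed.

(** [expmx] is a bare [limn], so the existence of the limit has to be shown: each entry is a series
    dominated by the scalar exponential series at [mx_sumnorm B]. *)
Lemma expmx_cvg B : horner_mx B (exp_poly 1 n) @[n --> \oo] --> expmx B.
Proof.
pose u := series (fun k : nat => k`!%:R^-1 *: B ^+ k).
have uE : u = (fun n => horner_mx B (exp_poly 1 n)).
  by apply/funext => n; rewrite /u expmx_series.
rewrite -uE; suff [L uL] : exists L : 'M[R]_d.+1, u n @[n --> \oo] --> L.
  by rewrite /expmx -/u (cvg_lim (@norm_hausdorff _ _) uL).
pose v i j n := \sum_(0 <= k < n) (k`!%:R^-1 *: B ^+ k) i j.
have cv i j : cvgn (v i j).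
  suff : cvgn [normed series (fun k => (k`!%:R^-1 *: B ^+ k) i j)].
    exact: normed_cvg.
  apply: (series_le_cvg _ _ _ (is_cvg_series_exp_coeff (mx_sumnorm B))).
  - by move=> k /=.
  - by move=> k; exact/exp_coeff_ge0/mx_sumnorm_ge0.
  - move=> k /=; rewrite mxE normrM exp_coeffE ler_pM ?mxX_le_sumnorm//.
    by rewrite ger0_norm// invr_ge0.
exists (\matrix_(i, j) limn (v i j)); apply: cvg_mx_entries => i j; rewrite mxE.
have -> : (fun k => u k i j) = v i j.
  by apply/funext => n; rewrite /u /series /= summxE.
exact: cv.
Qed.

Lemma trmx_horner_exp B n : B^T = - B ->
  (horner_mx B (exp_poly 1 n))^T = horner_mx B (exp_poly (-1) n).
Proof.
move=> skew; rewrite !horner_mx_poly linear_sum; apply: eq_bigr => k _.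
have BkT m : (B ^+ m)^T = (-1) ^+ m *: B ^+ m.
  elim: m => [|m IH]; first by rewrite !expr0 scale1r trmx1.
  rewrite [in LHS]exprS trmx_mul IH skew mulmxN -scalemxAl -scaleNr.
  by rewrite [(-1) ^+ m.+1]exprS mulN1r [in RHS]exprSr.
by rewrite linearZ/= BkT scalerA expr1n mul1r mulrC.
Qed.

Lemma cvg_mulmx_entries m n p (u : nat -> 'M[R]_(m, n)) (v : nat -> 'M[R]_(n, p))
    (A : 'M[R]_(m, n)) (C : 'M[R]_(n, p)) :
  (forall i j, u k i j @[k --> \oo] --> A i j) ->
  (forall i j, v k i j @[k --> \oo] --> C i j) ->
  forall i j, (u k *m v k) i j @[k --> \oo] --> (A *m C) i j.
Proof.
move=> uA vC i j; rewrite mxE.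
have -> : (fun k => (u k *m v k) i j) = (fun k => \sum_l u k i l * v k l j).
  by apply/funext => k; rewrite mxE.
apply: cvg_big => [|l _]; first exact: add_continuous.
by apply: cvgM; [exact: uA | exact: vC].
Qed.

(** By [exp_polyN_norm] the distance to the identity is at most the defect of the truncated scalar
    series in [exp beta ^ 2 = exp (2 beta)], and this defect tends to 0. *)
Lemma horner_exp_inv B i j :
  horner_mx B (exp_poly (-1) n * exp_poly 1 n) i j @[n --> \oo] --> (1%:M : 'M[R]_d.+1) i j.
Proof.
set beta := mx_sumnorm B.
have lim0 : ((exp_poly 1 n).[beta] ^+ 2 - (exp_poly 2 n).[beta]) @[n --> \oo] --> (0 : R).
  have -> : (0 : R) = expR (1 * beta) ^+ 2 - expR (2 * beta).
    by rewrite -expRM_natl mul1r subrr.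
  apply: cvgB; last exact: horner_exp_poly_cvg.
  rewrite expr2; under eq_fun do rewrite expr2.
  by apply: cvgM; exact: horner_exp_poly_cvg.
apply/cvgrPdist_le => e e0.
have /cvgrPdist_le/(_ _ e0) := lim0; apply: filterS2 (nbhs_infty_gt 0%N) => n n0.
rewrite sub0r normrN => h; apply: le_trans (le_trans (ler_norm _) h).
apply: le_trans (exp_polyN_norm (mx_sumnorm_ge0 B) n0).
move: (exp_poly (- 1 : R) n * exp_poly 1 n)
  (size_polyMleq (exp_poly (- 1 : R) n) (exp_poly 1 n)) => p sp.
have hB : horner_mx B (p - 1) = horner_mx B p - 1%:M.
  by rewrite rmorphB; congr (_ - _); exact: rmorph1.
have -> : (1%:M : 'M[R]_d.+1) i j - horner_mx B p i j = - (horner_mx B (p - 1)) i j.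
  move: hB => ->; move: (horner_mx B p) => H.
  by rewrite [X in _ = - X]mxE [X in _ = - (_ + X)]mxE opprB.
rewrite normrN; apply: horner_mx_entry_le.
rewrite (leq_trans (size_polyD _ _))// size_polyN size_poly1 geq_max.
rewrite (leq_trans sp) ?(leq_trans (leq_pred _)) ?leq_add ?size_poly//=.
by rewrite addn_gt0 n0.
Qed.

(** Transposing a truncated exponential of a skew [B] changes [B] to [- B], and [D] moves past any
    polynomial in [B]. The same sequence thus tends to the left side and to [D] times the
    identity. *)
Lemma expmx_invariant (D B : 'M[R]_d.+1) : B^T = - B -> B *m D = D *m B ->
  (expmx B)^T *m D *m expmx B = D.
Proof.
move=> skew BD; apply/matrixP => i j.
have SE k l : (horner_mx B (exp_poly 1 n)) k l @[n --> \oo] --> expmx B k l.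
  have h := @coord_continuous R d.+1 d.+1 k l (expmx B).
  have h' := cvg_comp _ _ (@expmx_cvg B) h.
  exact: h'.
have lim1 : ((horner_mx B (exp_poly 1 n))^T *m D *m horner_mx B (exp_poly 1 n)) i j
    @[n --> \oo] --> ((expmx B)^T *m D *m expmx B) i j.
  apply: cvg_mulmx_entries => [k l|//]; apply: cvg_mulmx_entries => k' l'.
    by rewrite mxE; under eq_fun do rewrite mxE; exact: SE.
  exact: cvg_cst.
have lim2 : ((horner_mx B (exp_poly 1 n))^T *m D *m horner_mx B (exp_poly 1 n)) i j
    @[n --> \oo] --> (D *m 1%:M) i j.
  have -> : (fun n => ((horner_mx B (exp_poly 1 n))^T *m D *m
      horner_mx B (exp_poly 1 n)) i j) =
      (fun n => (D *m horner_mx B (exp_poly (-1) n * exp_poly 1 n)) i j).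
    apply/funext => n; rewrite trmx_horner_exp// (comm_horner_mx _ BD) -mulmxA.
    by rewrite rmorphM.
  apply: cvg_mulmx_entries => k l; first exact: cvg_cst.
  exact: horner_exp_inv.
rewrite mulmx1 in lim2.
exact: (cvg_unique _ lim1 lim2).
Qed.

End expmx.

Lemma quad_expmx (R : realType) d (D B : 'M[R]_d) (x : 'cV[R]_d) : B^T = - B ->
  B *m D = D *m B -> quad D (expmx B *m x) = quad D x.
Proof.
case: d D B x => [|d] D B x skew BD.
  (* In dimension 0 all vectors coincide; the ring structure used for [expmx_invariant] lives on
     matrices of positive size. *)
  by congr (quad D); apply/matrixP => -[].
rewrite /quad trmx_mul; congr (_ ord0 ord0).
by rewrite -!mulmxA (mulmxA D) (mulmxA _ (D *m _)) [_ *m (D *m _)]mulmxA expmx_invariant// mulmxA.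
Qed.

(** * Functions of several variables *)

Section multivariate.
Context (R : realType) (d : nat).
Implicit Types (x y z v : 'cV[R]_d).

Lemma C1_is_derive_line (g : 'cV[R]_d -> 'cV[R]_d) x v i (s : R) :
  (forall z, differentiable g z) ->
  is_derive s 1 (fun s => g (s *: v + x) i ord0) ('d g (s *: v + x) v i ord0).
Proof.
move=> dg; set z := s *: v + x; pose f s := g (s *: v + x) i ord0.
have H : (h^-1 *: (f (h *: (1 : R) + s) - f s)) @[h --> (0 : R)^'] --> ('d g z v i ord0 : R).
  have dz : derivable g z v by exact: diff_derivable.
  have : (h^-1 *: (g (h *: v + z) - g z)) @[h --> (0 : R)^'] --> ('d g z v : 'cV[R]_d).
    by rewrite -deriveE//; exact: dz.
  move=> /(cvg_comp _ (fun M : 'cV[R]_d => M i ord0)).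
  move=> /(_ _ (@coord_continuous R d 1 i ord0 _)).
  apply: cvg_trans; apply: near_eq_cvg; near=> h => /=.
  by rewrite /f /z scalerDl addrA !mxE [h *: 1]mulr1.
apply: DeriveDef; first by apply/cvg_ex; exists ('d g z v i ord0).
exact: (cvg_lim (@norm_hausdorff _ _) H).
Unshelve. all: end_near. Qed.

Definition box (K : R) : set 'cV[R]_d := [set z | forall l, `|z l ord0| <= K].

Lemma continuous_bounded_box (f : 'cV[R]_d -> R) (K : R) : continuous f ->
  exists L, forall z, box K z -> `|f z| <= L.
Proof.
move=> cf.
(* The box is transposed to row vectors, where [rV_compact] applies to a product of segments. *)
pose A : set 'rV[R]_d := [set r | forall l, `[- K, K]%classic (r ord0 l)].
have cA : compact A.
  by apply: (@rV_compact R d (fun=> `[- K, K]%classic)) => _; exact: segment_compact.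
have ct : continuous (fun r : 'rV[R]_d => r^T).
  move=> r U [E nE EU]; exists (fun i j => E j i) => [i j|r' Er'].
    by have := nE j i; rewrite mxE.
  by apply: EU => i j; rewrite mxE; exact: Er'.
have : compact ((f \o trmx) @` A).
  apply: continuous_compact => //; apply: continuous_subspaceT => r.
  by apply: continuous_comp; [exact: ct | exact: cf].
move=> /compact_bounded[L [_ HL]]; exists (L + 1) => z zK.
apply: (HL (L + 1)); first by rewrite ltrDl.
exists z^T; last by rewrite /= trmxK.
by move=> l; rewrite /= in_itv/= mxE -ler_norml zK.
Qed.

(** Mean value theorem on the segment from [y] to [x], which stays in the convex box, where the
    partial derivatives are continuous and hence bounded. *)
Lemma C1_lipschitz_box (g : 'cV[R]_d -> 'cV[R]_d) (K : R) i : C1 g ->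
  exists L, forall x y, box K x -> box K y ->
    `|g x i ord0 - g y i ord0| <= L * \sum_l `|x l ord0 - y l ord0|.
Proof.
move=> [dg cg].
have /choice[L hL] : forall l, exists L, forall z, box K z ->
    `|'d g z (delta_mx l ord0) i ord0| <= L.
  move=> l; apply: (continuous_bounded_box (f := fun z => 'd g z (delta_mx l ord0) i ord0)).
  move=> z; apply: (@continuous_comp _ _ _ (fun z => 'd g z (delta_mx l ord0))
    (fun M : 'cV[R]_d => M i ord0)); [exact: cg | exact: coord_continuous].
exists (\sum_l `|L l|) => x y xK yK.
pose v := x - y.
pose f s := g (s *: v + y) i ord0.
have [|c] := @MVT_segment R f (fun s => 'd g (s *: v + y) v i ord0) 0 1 ler01
  (fun s _ => C1_is_derive_line y v i s dg).
  apply: continuous_subspaceT => s.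
  have [/derivable1_diffP/differentiable_continuous//] := C1_is_derive_line y v i s dg.
rewrite /f !subr0 scale1r scale0r add0r subrK mulr1 in_itv/= => /andP[c0 c1] ->.
have cK : box K (c *: v + y).
  move=> l; have -> : (c *: v + y) l ord0 = c * x l ord0 + (1 - c) * y l ord0.
    by rewrite !mxE; ring.
  have c1' : 0 <= 1 - c by rewrite subr_ge0.
  rewrite (le_trans (ler_normD _ _))// !normrM (ger0_norm c0) (ger0_norm c1').
  have := ler_wpM2l c0 (xK l); have := ler_wpM2l c1' (yK l); lra.
move: (c *: v + y) cK => z zK.
have -> : 'd g z v i ord0 =
    \sum_l (x l ord0 - y l ord0) * 'd g z (delta_mx l ord0) i ord0.
  rewrite [v]matrix_sum_delta linear_sum summxE; apply: eq_bigr => l _.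
  by rewrite big_ord1 linearZ !mxE.
rewrite (le_trans (ler_norm_sum _ _ _))// mulr_sumr; apply: ler_sum => l _.
rewrite normrM mulrC ler_wpM2r// (le_trans (hL l _ zK))//.
by rewrite (bigD1 l)//= (le_trans (ler_norm _))// lerDl sumr_ge0.
Qed.

(** Only the coordinates of [X] are known to be measurable, so the preimage of an open set is
    written as a countable union of preimages of rational cubes. [T] is left general in order to
    take the sigma-algebra of the past for it. *)
Lemma measurable_continuous_comp dT (T : measurableType dT) (X : T -> 'cV[R]_d)
    (f : 'cV[R]_d -> R) : (forall l, measurable_fun setT (fun w => X w l ord0)) ->
  continuous f -> measurable_fun setT (fun w => f (X w)).
Proof.
move=> mX cf; apply: (measurability _ (RGenOInfty.measurableE R)).
move=> /= _ [_ [r ->]] <-; rewrite setTI.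
pose U : set 'cV[R]_d := f @^-1` `]r, +oo[%classic.
pose cube (q : {ffun 'I_d -> rat} * nat) : set 'cV[R]_d :=
  [set z | forall l, `|z l ord0 - ratr (q.1 l)| < q.2.+1%:R^-1].
have -> : (fun w => f (X w)) @^-1` `]r, +oo[%classic =
    \bigcup_(q in [set q | cube q `<=` U]) (X @^-1` cube q).
  apply/seteqP; split => w; last by move=> [q qU Xq]; exact: qU.
  move=> /= Uw.
  have [e /= e0 he] : nbhs_ball (X w) U.
    have : nbhs (X w) U by apply: cf; apply: open_nbhs_nbhs; split.
    by rewrite -nbhs_ballE.
  have e2 : 0 < e / 2 by rewrite divr_gt0.
  (* A cube of radius below [e / 2] that contains [X w] lies in the ball of radius [e], by passing
     through its centre. *)
  have [n _ /(_ _ (leqnn n)) /= ne] := near_infty_natSinv_lt (PosNum e2).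
  have n0 : 0 < (n.+1%:R^-1 : R) by rewrite invr_gt0.
  have /choice[q hq] : forall l, exists q : rat, `|X w l ord0 - ratr q| < n.+1%:R^-1.
    move=> l; have lt2 : X w l ord0 - n.+1%:R^-1 < X w l ord0 + n.+1%:R^-1.
      by rewrite ltrD2l (lt_trans _ n0)// oppr_lt0.
    have [q] := rat_in_itvoo lt2; rewrite in_itv/= => /andP[q1 q2]; exists q.
    by rewrite ltr_distlC q1 q2.
  exists ([ffun l => q l], n); last by move=> l /=; rewrite ffunE.
  move=> z /= zq; apply: he; split => // l j; rewrite ord1.
  have := hq l; have := zq l; rewrite ffunE /ball/= => h1 h2.
  rewrite (_ : X w l ord0 - z l ord0 =
    (X w l ord0 - ratr (q l)) - (z l ord0 - ratr (q l))); last by ring.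
  by rewrite (le_lt_trans (ler_normB _ _))// (splitr e) ltrD// (lt_trans _ ne).
rewrite bigcup_mkcond; apply: countable_bigcupT_measurable; first exact: countableP.
move=> q; case: ifP => // _.
have -> : X @^-1` cube q = \bigcap_(l in [set: 'I_d])
    [set w | `|X w l ord0 - ratr (q.1 l)| < q.2.+1%:R^-1].
  by apply/seteqP; split => w /= h l => [_|]; exact: h.
apply: fin_bigcap_measurable => // l _; apply: measurable_set_ltr => //.
by apply: measurableT_comp => //; apply: measurable_funB.
Qed.

End multivariate.

(** * Stratonovich equations driven by Wiener processes *)

Section wiener_drivers.
Context (dO : measure_display) (Omega : measurableType dO) (R : realType).
Variable P : probability Omega R.
Variables (a b : R) (F : R -> set (set Omega)) (M : nat).
Variable W : 'I_M -> R -> Omega -> R.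
Hypotheses (hF : filtration a b F) (hW : wiener_family P a b F W) (ab : a < b).

Lemma driver_adapted m : adapted a b F (driver W m).
Proof.
have [_ _ aW _] := hW; rewrite /driver; case: unlift => [k|]; first exact: aW.
move=> u uab; have sF : sigma_algebra setT (F u) by case: hF => h _ _; exact: h.
by apply/(sub_measurableP sF); exact: measurable_cst.
Qed.

Lemma driver_continuous m : continuous_process P a b (driver W m).
Proof.
have [wW _ _ _] := hW; rewrite /driver; case: unlift => [k|]; first by case: (wW k).
by apply: aeW => w; apply: continuous_subspaceT => x; exact: cvg_id.
Qed.

Lemma driver_ito m : exists2 C, 0 < C & ito_driver P a b F (driver W m) C.
Proof.
have [wW _ aW indep] := hW; rewrite /driver; case: unlift => [k|]; last first.
  by exists (b - a); [rewrite subr_gt0 | exact: time_ito_driver].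
exists 8 => //; apply: brownian_ito_driver => //.
move=> s t sab tab st A B FA mB; apply: (indep s sab) => //.
(* The increment of one component is among the generators of the sigma-algebra of joint increments
   after [s]. *)
apply: sub_sigma_algebra; exists (k, t) => /=.
  by move: tab st; rewrite !in_itv/= => /andP[_ ->] /ltW ->.
by exists B => //; rewrite setTI.
Qed.

End wiener_drivers.

Lemma quadE (R : realType) d (D : 'M[R]_d) (x : 'cV[R]_d) :
  quad D x = \sum_l (D *m x) l ord0 * x l ord0.
Proof.
by rewrite /quad -mulmxA mxE; apply: eq_bigr => l _; rewrite mxE mulrC.
Qed.

Lemma continuous_mulmx_entry (R : realType) d (B : 'M[R]_d) l :
  continuous (fun z : 'cV[R]_d => (B *m z) l ord0).
Proof.
have -> : (fun z : 'cV[R]_d => (B *m z) l ord0) =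
    (fun z => \sum_k B l k * z k ord0) by apply/funext => y; rewrite mxE.
apply: continuous_big => [|k _ z]; first exact: add_continuous.
by apply: continuousM; [exact: cst_continuous | exact: coord_continuous].
Qed.

(** Since [B] is skew and commutes with the symmetric [D], the product [D *m B] is skew, so
    [x^T *m D *m B *m x] is a 1 by 1 matrix equal to its opposite. *)
Lemma quad_orthogonal (R : realType) d (D B : 'M[R]_d) (x u : 'cV[R]_d) :
  D^T = D -> B^T = - B -> B *m D = D *m B -> x^T *m D *m u = 0 ->
  \sum_l (D *m x) l ord0 * (B *m x + u) l ord0 = 0.
Proof.
move=> sym skew BD xDu.
have -> : \sum_l (D *m x) l ord0 * (B *m x + u) l ord0 =
    (x^T *m D *m (B *m x + u)) ord0 ord0.
  rewrite mxE; apply: eq_bigr => l _; congr (_ * _).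
  by rewrite -{2}sym -trmx_mul [in RHS]mxE.
rewrite mulmxDr xDu addr0.
set q := _ *m _; have : q^T = - q.
  by rewrite /q !trmx_mul trmxK skew sym mulmxA -!mulmxA mulNmx !mulmxN (mulmxA B) BD !mulmxA.
move=> /matrixP/(_ ord0 ord0); rewrite mxE [RHS]mxE => /eqP.
by rewrite -subr_eq0 opprK -mulr2n mulrn_eq0 /= => /eqP.
Qed.

(** * Conservation of the quadratic form along the solution *)

Section invariant.
Context (dO : measure_display) (Omega : measurableType dO) (R : realType).
Variable P : probability Omega R.
Variables (d M : nat) (t0 T : R) (F : R -> set (set Omega)).
Variables (W : 'I_M -> R -> Omega -> R) (A : 'I_M.+1 -> 'M[R]_d).
Variables (g : 'I_M.+1 -> 'cV[R]_d -> 'cV[R]_d) (D : 'M[R]_d).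
Variables (X0 : Omega -> 'cV[R]_d) (X : R -> Omega -> 'cV[R]_d).
Hypotheses (hF : filtration t0 T F) (hW : wiener_family P t0 T F W).
Hypothesis hg : forall m, C1 (g m).
Hypothesis hX : stratonovich_solution P F t0 T (driver W) (sde_coef A g X) X0 X.
Hypotheses (hD : D^T = D) (hAskew : forall m, (A m)^T = - A m).
Hypothesis hAD : forall m, A m *m D = D *m A m.
Hypothesis hgD : forall m x, x^T *m D *m g m x = 0.

Let continuous_comp_process (f : 'cV[R]_d -> R) : continuous f ->
  continuous_process P t0 T (fun u w => f (X u w)).
Proof.
move=> cf; have [_ cX _ _] := hX.
by apply: filterS cX => w cw x; apply: continuous_comp; [exact: cw | exact: cf].
Qed.

Let adapted_comp (f : 'cV[R]_d -> R) : continuous f ->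
  adapted t0 T F (fun u w => f (X u w)).
Proof.
move=> cf; have [aX _ _ _] := hX => u uab.
have sF : sigma_algebra setT (F u) by case: hF => h _ _; exact: h.
apply/(sub_measurableP sF); apply: measurable_continuous_comp => // l.
by apply/(sub_measurableP sF) => B mB; exact: aX.
Qed.

Let coef_continuous m l : continuous (fun z : 'cV[R]_d => (A m *m z + g m z) l ord0).
Proof.
have -> : (fun z : 'cV[R]_d => (A m *m z + g m z) l ord0) =
    (fun z => (A m *m z) l ord0 + g m z l ord0) by apply/funext => y; rewrite mxE.
move=> z; apply: continuousD; first exact: continuous_mulmx_entry.
apply: (@continuous_comp _ _ _ (g m) (fun B : 'cV[R]_d => B l ord0)).
  by apply: differentiable_continuous; case: (hg m).
exact: coord_continuous.
Qed.

Lemma quad_solution_at t : t \in `[t0, T] ->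
  {ae P, forall w, quad D (X t w) = quad D (X t0 w)}.
Proof.
(* The initial time is set apart because dyadic partitions need an interval of positive length. *)
rewrite in_itv/= le_eqVlt => /andP[/predU1P[<- _|t0t tT]]; first exact: aeW.
have t0T := lt_le_trans t0t tT.
have [aX cX _ [S [hS XE]]] := hX.
have /choice[C hC] : forall m, exists C, 0 < C /\ ito_driver P t0 T F (driver W m) C.
  by move=> m; have [C] := driver_ito hF hW t0T m; exists C.
have := @quadratic_invariant_at _ _ _ P t0 T t F hF t0t tT d M.+1
  (fun l u w => X u w l ord0) (fun l u w => (D *m X u w) l ord0) D
  (fun m l u w => sde_coef A g X m u w l ord0) (fun m l u w => S m u w l ord0)
  (driver W) C.
move=> H; have : {ae P, forall w, \sum_l (D *m X t w) l ord0 * X t w l ord0 =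
    \sum_l (D *m X t0 w) l ord0 * X t0 w l ord0}; last first.
  by apply: filterS => w; rewrite !quadE.
apply: H.
- by move=> m; case: (hC m).
- by move=> m; case: (hC m).
- by move=> m; exact: driver_adapted hF hW m.
- by move=> m; exact: driver_continuous hW m.
- exact: aX.
- by move=> l; apply: (continuous_comp_process (f := fun z => z l ord0)); exact: coord_continuous.
- move=> l; apply: (adapted_comp (f := fun z => (D *m z) l ord0)).
  exact: continuous_mulmx_entry.
- move=> l; apply: (continuous_comp_process (f := fun z => (D *m z) l ord0)).
  exact: continuous_mulmx_entry.
- by move=> m l; exact: (adapted_comp (@coef_continuous m l)).
- by move=> m l; exact: (continuous_comp_process (@coef_continuous m l)).
- exact: hD.
- by move=> l u w; rewrite mxE.
- move=> m l K; have [L hL] := C1_lipschitz_box K l (hg m).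
  exists (\sum_k `|A m l k| + L) => u v w uK vK.
  rewrite /sde_coef.
  have -> : (A m *m X u w + g m (X u w)) l ord0 - (A m *m X v w + g m (X v w)) l ord0 =
      \sum_k A m l k * (X u w k ord0 - X v w k ord0) +
      (g m (X u w) l ord0 - g m (X v w) l ord0).
    rewrite [X in X - _]mxE [X in _ - X]mxE [(A m *m X u w) _ _]mxE.
    rewrite [(A m *m X v w) _ _]mxE opprD addrACA -sumrB; congr (_ + _).
    by apply: eq_bigr => k _; rewrite mulrBr.
  rewrite (le_trans (ler_normD _ _))// mulrDl lerD//; last exact: hL.
  rewrite (le_trans (ler_norm_sum _ _ _))// mulr_sumr; apply: ler_sum => k _.
  rewrite normrM ler_wpM2r// (bigD1 k)//= lerDl sumr_ge0//.
- by move=> m u w; apply: quad_orthogonal.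
- exact: hS.
- apply: filterS XE => w h u uab l; rewrite (h u uab) mxE summxE.
  by [].
Qed.

(** The null set of [quad_solution_at] depends on [t]. Countably many of them are united over the
    clipped rationals, and continuity of the paths reaches the other times. *)
Lemma quad_solution :
  {ae P, forall w, forall t, t \in `[t0, T] -> quad D (X t w) = quad D (X t0 w)}.
Proof.
have [Tt0|t0T] := ltP T t0.
  apply: aeW => w t; rewrite in_itv/= => /andP[h1 h2].
  by have := le_lt_trans (le_trans h1 h2) Tt0; rewrite ltxx.
(* The rationals are enumerated through [unpickle] so that [ae_foralln] can collect the null
   sets. *)
have aeq : {ae P, forall w, forall n : nat, forall q, unpickle n = Some q ->
    quad D (X (clip_rat t0 T q) w) = quad D (X t0 w)}.
  apply: ae_foralln => n; case: (unpickle n) => [q|]; last exact: aeW.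
  apply: filterS (quad_solution_at (clip_in t0T q)) => w h q' [<-]; exact: h.
have cq : continuous_process P t0 T (fun u w => quad D (X u w)).
  apply: continuous_comp_process.
  have -> : quad D = (fun z => \sum_l (D *m z) l ord0 * z l ord0).
    by apply/funext => y; rewrite quadE.
  apply: continuous_big => [|l _ z]; first exact: add_continuous.
  by apply: continuousM; [exact: continuous_mulmx_entry | exact: coord_continuous].
apply: filterS2 aeq cq => w hq cw t tab.
apply/eqP; rewrite -subr_eq0 -normr_le0; apply/ler_addgt0Pr => e e0; rewrite add0r.
have [r r0 hr] := within_itv_continuousE cw tab e0.
have [q tq] := clip_dense tab r0.
rewrite -(hq (pickle q) q (pickleK q)); apply/ltW/hr => //; exact: clip_in.
Qed.

End invariant.

Theorem lemma3 (dO : measure_display) (Omega : measurableType dO)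
    (R : realType) (P : probability Omega R) (d M : nat) (t0 T : R)
    (F : R -> set (set Omega)) (W : 'I_M -> R -> Omega -> R)
    (A : 'I_M.+1 -> 'M[R]_d) (g : 'I_M.+1 -> 'cV[R]_d -> 'cV[R]_d)
    (D : 'M[R]_d) (X0 : 'cV[R]_d) (X : R -> Omega -> 'cV[R]_d)
    (tn : R) (V : R -> Omega -> 'cV[R]_d)
    (hF : filtration t0 T F)
    (hW : wiener_family P t0 T F W)
    (hg : forall m, C1 (g m))
    (hunique : forall x0 : 'cV[R]_d,
       exists Y : R -> Omega -> 'cV[R]_d,
         stratonovich_solution P F t0 T (driver W) (sde_coef A g Y)
           (fun=> x0) Y /\
         forall Y' : R -> Omega -> 'cV[R]_d,
           stratonovich_solution P F t0 T (driver W) (sde_coef A g Y')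
             (fun=> x0) Y' ->
           {ae P, forall w, forall t, t \in `[t0, T] -> Y' t w = Y t w})
    (hX : stratonovich_solution P F t0 T (driver W) (sde_coef A g X)
            (fun=> X0) X)
    (hD : D^T = D)
    (hAA : forall l k, A l *m A k - A k *m A l = 0)
    (hAskew : forall m, (A m)^T = - A m)
    (hAD : forall m, A m *m D = D *m A m)
    (hgD : forall m x, x^T *m D *m g m x = 0)
    (htn : tn \in `[t0, T])
    (hV : stratonovich_solution P F tn T (driver W)
            (transformed_coef W A g tn V) (X tn) V)
    (hVX : {ae P, forall w, forall t, t \in `[tn, T] ->
              V t w = expmx (- lawson_log W A tn t w) *m X t w}) :
  {ae P, forall w, forall t, t \in `[tn, T] ->
     quad D (V t w) = quad D (X t w) /\ quad D (X t w) = quad D (X t0 w)}.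
Proof.
have quadX := quad_solution hF hW hg hX hD hAskew hAD hgD.
apply: filterS2 quadX hVX => w Xw Vw t ttn; split; last first.
  apply: Xw; move: ttn htn; rewrite !in_itv/= => /andP[ht ->] /andP[h _].
  by rewrite (le_trans h ht).
(* At fixed [t] and [w] the exponent is a real linear combination of the [A m], so skew-symmetry and
   commutation with [D] pass to it from each of them. *)
have skewL : (- lawson_log W A tn t w)^T = - - lawson_log W A tn t w.
  rewrite linearN; congr (- _); rewrite /lawson_log linear_sum -sumrN.
  apply: eq_bigr => m _.
  by rewrite linearZ/= hAskew scalerN.
rewrite Vw// quad_expmx// mulNmx mulmxN /lawson_log mulmx_suml mulmx_sumr.
by congr (- _); apply: eq_bigr => m _; rewrite -scalemxAl -scalemxAr hAD.
Qed.
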